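(* Let $(F|K,v)$ be a valued function field such that $v$ is trivial on $K$. Assume that for every finite set $Z\subseteq\mathcal O_F$ there exist a transcendence basis $T$ of $F|K$ and elements $\eta_1,\ldots,\eta_r\in\mathcal O_F$ which are henselian over $\mathcal O_{K(T)}$ such that $(K(T)|K,v)$ admits local uniformization and $Z\subseteq\mathcal O_{K(T)}[\eta_1,\ldots,\eta_r]$. Then $(F|K,v)$ admits local uniformization.
   Context: A valued function field $(F|K,v)$ is an algebraic function field $F|K$ (a finitely generated field extension) together with a (Krull) valuation $v$ on $F$. For a subfield $E\subseteq F$, $\mathcal O_E=\mathcal O_v\cap E$ and $\mathfrak m_E=\mathfrak m_v\cap E$, and $E$ carries the restriction of $v$. For an extension $A\subseteq B$ of commutative rings with unity, $b\in B$ is henselian over $A$ if there is $h(X)\in A[X]$ (not necessarily monic) with $h(b)=0$ and $h'(b)$ a unit of $B$; here $A=\mathcal O_{K(T)}$ and $B=\mathcal O_F$. For $v$ trivial on $K$, an affine model of $(F|K,v)$ on which $v$ has a center is $V=\mathrm{Spec}(R)$ with $R\subseteq\mathcal O_F$ a finitely generated $K$-algebra whose quotient field is $F$; the center of $v$ on $V$ is the prime $\mathfrak p=R\cap\mathfrak m_F$, and $\mathcal O_{V,\mathfrak p}=R_{\mathfrak p}$. $(F|K,v)$ admits local uniformization if for every finite set $Z\subseteq\mathcal O_F$ there exists an affine model $V$ of $(F|K,v)$ such that the center $\mathfrak p$ of $v$ on $V$ is a regular point (i.e. $\mathcal O_{V,\mathfrak p}$ is a regular local ring) and $Z\subseteq\mathcal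 O_{V,\mathfrak p}$. The same definition applies to $(K(T)|K,v)$. *)

(* Defs.v *)
From mathcomp Require Import all_boot all_order all_algebra.
From mathcomp Require Import boolp classical_sets.
From mathcomp Require Import mpoly.

Set Implicit Arguments.
Unset Strict Implicit.
Unset Printing Implicit Defensive.

Import Order.TTheory GRing.Theory Num.Theory.
Local Open Scope ring_scope.
Local Open Scope classical_set_scope.

(* All fields and rings in play are subsets of one ambient field F, so that
   F|K and K(T)|K are instances of the same notions. *)

Section Subrings.
Variable L : comNzRingType.
Implicit Types A I P M : set L.

Definition subring A : Prop := GRing.subring_closed (mem A).

(* A[S] *)
Definition ring_adjoin A (S : set L) : set L := smallest subring (A `|` S).

(* The following notions refer to A as a ring in its own right: the ideals
   are those of A, not of L. *)

Record ideal A I : Prop := Ideal {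
  ideal_sub : I `<=` A;
  ideal0 : I 0;
  idealD : forall x y, I x -> I y -> I (x + y);
  idealM : forall a x, A a -> I x -> I (a * x) }.

Definition ideal_span A n (g : 'I_n -> L) : set L :=
  [set x | exists2 a : 'I_n -> L, (forall i, A (a i)) & x = \sum_(i < n) a i * g i].

Definition prime_ideal A P : Prop :=
  [/\ ideal A P, ~ P 1
    & forall x y, A x -> A y -> P (x * y) -> P x \/ P y].

Definition maximal_ideal A M : Prop :=
  [/\ ideal A M, ~ M 1
    & forall I, ideal A I -> ~ I 1 -> M `<=` I -> I = M].

Definition local_ring A M : Prop :=
  maximal_ideal A M /\ forall M', maximal_ideal A M' -> M' = M.

Definition noetherian A : Prop :=
  forall I, ideal A I -> exists n (g : 'I_n -> L), I = ideal_span A g.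

Definition prime_chain A n (P : 'I_n.+1 -> set L) : Prop :=
  (forall i, prime_ideal A (P i)) /\
  (forall i j : 'I_n.+1, (i < j)%N -> P i `<` P j).

Definition krull_dim A d : Prop :=
  (exists P : 'I_d.+1 -> set L, prime_chain A P) /\
  (forall n (P : 'I_n.+1 -> set L), prime_chain A P -> (n <= d)%N).

Definition regular_local_ring A : Prop :=
  [/\ subring A, noetherian A
    & exists M, local_ring A M /\
      exists2 d, krull_dim A d & exists g : 'I_d -> L, M = ideal_span A g].

End Subrings.

Section Fields.
Variable F : fieldType.
Implicit Types A B E K R S T : set F.

Definition subfield K : Prop := GRing.divring_closed (mem K).

(* K(S) *)
Definition field_adjoin K S : set F := smallest subfield (K `|` S).

Definition quotient_field R : set F :=
  [set x | exists a b, [/\ R a, R b, b != 0 & x = a / b]].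

(* R_P, realized inside F; meant for a domain R in F and a prime P of R. *)
Definition localization R P : set F :=
  [set x | exists a b, [/\ R a, R b, ~ P b & x = a / b]].

Definition finitely_generated_field K E : Prop :=
  exists s : seq F, E = field_adjoin K [set` s].

Definition algebraically_independent K T : Prop :=
  forall n (t : 'I_n -> F), injective t -> (forall i, T (t i)) ->
  forall p : {mpoly F[n]}, p \is a mpolyOver n (mem K) -> p.@[t] = 0 -> p = 0.

Definition algebraic_over K x : Prop :=
  exists p : {poly F}, [/\ p \is a polyOver (mem K), p != 0 & root p x].

(* T need not be finite a priori; it is a basis of the ambient field F over K. *)
Definition transcendence_basis K T : Prop :=
  algebraically_independent K T /\
  forall x : F, algebraic_over (field_adjoin K T) x.

Definition henselian_over A B b : Prop :=
  B b /\ exists h : {poly F},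
    [/\ h \is a polyOver (mem A), h.[b] = 0, B h^`().[b]
      & exists2 u, B u & h^`().[b] * u = 1].

End Fields.

(* [porderZmodType] imposes no relation between the order and the addition. *)
Definition ordered_abelian_group (G : porderZmodType) : Prop :=
  total (<=%R : rel G) /\ forall x y z : G, x <= y -> z + x <= z + y.

(* Only the values of v on nonzero elements are meaningful: v 0, which is
   conventionally infinite, is left arbitrary and never used. *)
Record krull_valuation (F : fieldType) (G : porderZmodType) (v : F -> G) : Prop :=
  KrullValuation {
    value_group : ordered_abelian_group G;
    valuationM : forall x y, x != 0 -> y != 0 -> v (x * y) = v x + v y;
    valuationD : forall x y, x != 0 -> y != 0 -> x + y != 0 ->
      Order.min (v x) (v y) <= v (x + y) }.

Section Uniformization.
Variables (F : fieldType) (G : porderZmodType) (v : F -> G).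
Implicit Types E K R : set F.

Definition trivial_on K : Prop := forall x, K x -> x != 0 -> v x = 0.

(* O_E and m_E; both contain 0, whose value is infinite. *)
Definition val_ring E : set F := [set x | E x /\ (x != 0 -> 0 <= v x)].
Definition val_ideal E : set F := [set x | E x /\ (x != 0 -> 0 < v x)].

(* R is the coordinate ring of an affine model of (E|K,v) on which v has a
   center. *)
Definition affine_model K E R : Prop :=
  [/\ exists s : seq F, R = ring_adjoin K [set` s],
      R `<=` val_ring E
    & quotient_field R = E].

Definition center E R : set F := R `&` val_ideal E.

Definition admits_local_uniformization K E : Prop :=
  forall Z : seq F, [set` Z] `<=` val_ring E ->
  exists R, [/\ affine_model K E R,
    regular_local_ring (localization R (center E R))
    & [set` Z] `<=` localization R (center E R)].

End Uniformization.

(* Main.v *)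
Require Import Defs.
From mathcomp Require Import all_boot all_order all_algebra.
From mathcomp Require Import boolp classical_sets.
From HB Require Import structures.
From mathcomp Require Import ring zify.

(* Let A be the local ring of the given regular centre on a model of K(T), on
   which the coefficients of the polynomials h exhibiting the eta_i as henselian
   elements, and those expressing the elements of Z in the eta_i, are regular.
   Adjoining the eta_i to that model, one at a time, gives the wanted model of
   F; to be proved is that B = A[eta]_Q is again regular, Q being the set of f
   with f(eta) of positive value. The maximal ideal of B is generated by the d
   parameters of A, since h is, up to a factor outside Q, congruent modulo the
   maximal ideal of A to a lift of the minimal polynomial of the residue of eta;
   so dim B <= d by Krull's height theorem. For dim B >= d, a chain of d + 1
   primes of A extends to A[X] and, ending with Q, has d + 2 members; by the
   principal ideal theorem it can be bent so that its second member J contains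
   h. Then J is generated by h locally at Q, because Q is generated by h and d
   parameters (this is the proof that regular local rings are domains). As h
   has eta as a simple root, the kernel of f |-> f(eta) is contained in J,
   hence equal to it, and the primes from J to Q yield primes of B. *)

Set Implicit Arguments.
Unset Strict Implicit.
Unset Printing Implicit Defensive.

Import Order.TTheory GRing.Theory Num.Theory.
Local Open Scope ring_scope.
Local Open Scope classical_set_scope.

(** * Saturated ideals *)

Section Saturation.
Variable D : comNzRingType.
Implicit Types I J P Q R S : set D.

Definition ideal_gen S : set D := smallest (ideal [set: D]) S.

(* [saturation R I] is the preimage in D of the extension of I to the
   localization D_R; working with it avoids constructing D_R. *)
Definition saturation R I : set D := [set y | exists2 s, ~ R s & I (s * y)].

Definition saturated R I : Prop := forall s y, ~ R s -> I (s * y) -> I y.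

Lemma idealN I x : ideal [set: D] I -> I x -> I (- x).
Proof. by move=> iI Ix; rewrite -mulN1r; apply: (idealM iI). Qed.

Lemma idealB I x y : ideal [set: D] I -> I x -> I y -> I (x - y).
Proof. by move=> iI Ix Iy; apply: (idealD iI) => //; apply: idealN. Qed.

Lemma idealMl I a x : ideal [set: D] I -> I x -> I (a * x).
Proof. by move=> iI; apply: (idealM iI). Qed.

Lemma idealMr I a x : ideal [set: D] I -> I a -> I (a * x).
Proof. by move=> iI; rewrite mulrC; apply: idealMl. Qed.

Lemma ideal_addKl I x y : ideal [set: D] I -> I (x + y) -> I x -> I y.
Proof. by move=> iI Ixy Ix; rewrite -[y](addKr x) addrC; apply: idealB. Qed.

Lemma ideal_sum I (T : Type) (r : seq T) (p : pred T) (f : T -> D) :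
  ideal [set: D] I -> (forall i, p i -> I (f i)) -> I (\sum_(i <- r | p i) f i).
Proof.
by move=> iI If; elim/big_ind: _ => //; [apply: (ideal0 iI)|apply: (idealD iI)].
Qed.

Lemma prime_ideal_ideal P : prime_ideal [set: D] P -> ideal [set: D] P.
Proof. by case. Qed.

Lemma primeM P x y : prime_ideal [set: D] P -> P (x * y) -> P x \/ P y.
Proof. by case=> _ _ PM; apply: PM. Qed.

Lemma primeNM P x y : prime_ideal [set: D] P -> ~ P x -> ~ P y -> ~ P (x * y).
Proof. by move=> pP nx ny /(primeM pP)[]. Qed.

Lemma prime_saturated P R : prime_ideal [set: D] P -> P `<=` R -> saturated R P.
Proof. by move=> pP PR s y Rs /(primeM pP)[/PR|]. Qed.

Lemma ideal_ideal_gen S : ideal [set: D] (ideal_gen S).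
Proof.
split=> //.
- by move=> I [iI _]; apply: (ideal0 iI).
- by move=> x y gx gy I IS; apply: (idealD IS.1); [apply: gx|apply: gy].
- by move=> a x _ gx I IS; apply: (idealMl _ IS.1); apply: gx.
Qed.

Lemma sub_ideal_gen S : S `<=` ideal_gen S.
Proof. by move=> x Sx I [_]; apply. Qed.

Lemma ideal_gen_sub S I : ideal [set: D] I -> S `<=` I -> ideal_gen S `<=` I.
Proof. by move=> iI SI x; apply. Qed.

Lemma ideal_genU1 S x z :
  ideal_gen (x |` S) z -> exists2 w, ideal_gen S w & exists c, z = w + c * x.
Proof.
move: z; apply: ideal_gen_sub.
  split=> //.
  - by exists 0; [apply: (ideal0 (ideal_ideal_gen S))|exists 0; ring].
  - move=> _ _ [w Sw [c ->]] [w' Sw' [c' ->]]; exists (w + w').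
      exact: (idealD (ideal_ideal_gen S)).
    by exists (c + c'); ring.
  - move=> a _ _ [w Sw [c ->]]; exists (a * w).
      exact: (idealMl _ (ideal_ideal_gen S)).
    by exists (a * c); ring.
move=> z [->|Sz].
  by exists 0; [apply: (ideal0 (ideal_ideal_gen S))|exists 1; ring].
by exists z; [apply: sub_ideal_gen|exists 0; ring].
Qed.

Lemma ideal_gen_idU1 I x z : ideal [set: D] I ->
  ideal_gen (x |` I) z -> exists2 w, I w & exists c, z = w + c * x.
Proof.
by move=> iI /ideal_genU1[w /(ideal_gen_sub iI) Iw E]; exists w => //; apply: Iw.
Qed.

Section PrimeSaturation.
Variable R : set D.
Hypothesis pR : prime_ideal [set: D] R.

Let R1 : ~ R 1. Proof. by case: pR. Qed.

Lemma ideal_saturation I : ideal [set: D] I -> ideal [set: D] (saturation R I).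
Proof.
move=> iI; split=> //.
- by exists 1; rewrite ?mulr0 //; apply: (ideal0 iI).
- move=> x y [s Rs Isx] [t Rt Ity]; exists (s * t); first exact: primeNM.
  rewrite (_ : _ * _ = t * (s * x) + s * (t * y)); last by ring.
  by apply: (idealD iI); apply: idealMl.
- move=> a x _ [s Rs Isx]; exists s => //; rewrite mulrCA; exact: idealMl.
Qed.

Lemma saturated_saturation I : saturated R (saturation R I).
Proof.
by move=> s y Rs [t Rt Itsy]; exists (t * s); [apply: primeNM|rewrite -mulrA].
Qed.

Lemma sub_saturation I : I `<=` saturation R I.
Proof. by move=> x Ix; exists 1; rewrite ?mul1r. Qed.

Lemma saturation_sub I J : saturated R J -> I `<=` J -> saturation R I `<=` J.
Proof. by move=> sJ IJ x [s Rs /IJ]; apply: sJ. Qed.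

(** Elements outside [R] become units in D_R. *)
Lemma saturated_proper I : saturated R I -> ~ I 1 -> I `<=` R.
Proof.
move=> sI I1 x Ix; apply: contrapT => Rx; apply: I1.
by apply: (sI x) => //; rewrite mulr1.
Qed.

End PrimeSaturation.
End Saturation.

(** * Maximal ideals of a family, Nakayama's lemma and descending chains *)

Section Noetherian.
Variable D : comNzRingType.
Hypothesis noethD : noetherian [set: D].
Implicit Types I J P Q R S : set D.

(** A family without maximal member yields, by dependent choice, a strictly increasing sequence of
    ideals; but finitely many generators of its union already lie in one of them. *)
Lemma noetherian_max (Phi : set D -> Prop) I0 :
  (forall I, Phi I -> ideal [set: D] I) -> Phi I0 ->
  exists2 I, Phi I & forall J, Phi J -> I `<=` J -> J `<=` I.
Proof.
move=> iPhi PhiI0; apply: contrapT => noMax.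
have /choice[nxt nxtP] : forall I : {I | Phi I}, exists J : {I | Phi I},
    sval I `<` sval J.
  case=> I PhiI; apply: contrapT => noJ; apply: noMax; exists I => // J PhiJ IJ.
  by apply: contrapT => JI; apply: noJ; exists (exist _ J PhiJ).
pose s k := sval (iter k nxt (exist _ I0 PhiI0)).
have sD k n : s k `<=` s (k + n)%N.
  elim: n => [|n IH]; first by rewrite addn0.
  by rewrite addnS; apply: subset_trans IH _; case: (nxtP (iter (k + n) nxt (exist _ I0 PhiI0))).
have si k : ideal [set: D] (s k) by apply: iPhi; apply: (svalP (iter k nxt _)).
have iU : ideal [set: D] [set x | exists k, s k x].
  split=> //; first by exists 0%N; apply: (ideal0 (si _)).
    move=> x y [k sx] [n sy]; exists (k + n)%N; apply: (idealD (si _)).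
      exact: sD.
    by rewrite addnC; apply: sD.
  by move=> a x _ [k sx]; exists k; apply: idealMl.
have [n [g Ug]] := noethD iU.
have /choice[f fP] : forall i, exists k, s k (g i).
  move=> i; suff : [set x | exists k, s k x] (g i) by [].
  rewrite Ug; exists (fun j => (j == i)%:R) => //.
  by rewrite (bigD1 i) //= eqxx mul1r big1 ?addr0 // => j /negPf->; rewrite mul0r.
pose m := \sum_i f i.
have /(_ m.+1) UsubS : forall k, s k `<=` s m.
  move=> k x skx; have : [set x | exists k, s k x] x by exists k.
  rewrite Ug => -[a _ ->]; apply: ideal_sum => // i _; apply: idealMl => //.
  by rewrite /m (bigD1 i) //=; apply: sD.
by case: (nxtP (iter m nxt (exist _ I0 PhiI0))) => _; apply.
Qed.

(** Nakayama's lemma in D_R for [I] contained in J + x I. In place of finitely many generators of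
    [I], the proof works with an ideal [M] maximal among the saturated ones that contain [J] but not
    [I]. *)
Lemma nakayama R I J x : prime_ideal [set: D] R ->
  ideal [set: D] J -> saturated R J -> R x ->
  (forall z, I z -> exists2 s, ~ R s & exists2 w, J w & exists2 t, I t & s * z = w + x * t) ->
  I `<=` J.
Proof.
move=> pR iJ sJ Rx IJ; apply: contrapT => nIJ.
have [||M [iM sM JM nIM] Mmax] := @noetherian_max
  (fun M => [/\ ideal [set: D] M, saturated R M, J `<=` M & ~ I `<=` M]) J.
- by move=> M [].
- by split.
(* By maximality of [M], adjoining any further element captures all of [I]. *)
have step z : ~ M z -> I `<=` saturation R (ideal_gen (z |` M)).
  move=> Mz; apply: contrapT => nI; apply: Mz.
  have igM := ideal_ideal_gen (z |` M).
  apply: (Mmax (saturation R (ideal_gen (z |` M)))).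
  - split=> //; [exact: ideal_saturation|exact: saturated_saturation|].
    by apply: subset_trans JM _ => y My; apply: sub_saturation => //; apply: sub_ideal_gen; right.
  - by move=> y My; apply: sub_saturation => //; apply: sub_ideal_gen; right.
  - by apply: sub_saturation => //; apply: sub_ideal_gen; left.
have [z [Iz Mz]] : exists z, I z /\ ~ M z.
  apply: contrapT => nz; apply: nIM => z Iz; apply: contrapT => Mz; apply: nz.
  by exists z.
(* Otherwise [s * z = w + c * (x * z)] with [w] in [M]; as [s - c * x] is still outside [R], this
   would put [z] into [M]. *)
have Mxz : M (x * z).
  apply: contrapT => /step/(_ z Iz)[s Rs /(ideal_gen_idU1 iM)[w Mw [c E]]].
  apply: Mz; apply: (sM (s - c * x)).
    move=> Rscx; apply: Rs; rewrite -(subrK (c * x) s).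
    by have iR := prime_ideal_ideal pR; apply: (idealD iR) => //; apply: idealMl.
  by rewrite mulrBl E -mulrA addrK.
have Mxt t : I t -> M (x * t).
  move=> /(step z Mz)[s Rs /(ideal_gen_idU1 iM)[w Mw [c E]]].
  apply: (sM s) => //; rewrite mulrCA E mulrDr.
  by apply: (idealD iM); [apply: idealMl|rewrite mulrCA; apply: idealMl].
have [s Rs [w Jw [t It E]]] := IJ z Iz.
by apply: Mz; apply: (sM s) => //; rewrite E; apply: (idealD iM); [apply: JM|apply: Mxt].
Qed.

(** An associated prime of D / I: an annihilator of a nonzero class that is maximal among such
    annihilators is prime. *)
Lemma prime_colon I : ideal [set: D] I -> ~ I 1 ->
  exists2 y, ~ I y & prime_ideal [set: D] [set a | I (a * y)].
Proof.
move=> iI I1.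
have icol y : ideal [set: D] [set a | I (a * y)].
  split=> //=; first by rewrite mul0r; apply: (ideal0 iI).
    by move=> a b Ia Ib; rewrite mulrDl; apply: (idealD iI).
  by move=> a b _ Ib; rewrite -mulrA; apply: idealMl.
have [||_ [y Iy ->] ymax] := @noetherian_max
  (fun J => exists2 y, ~ I y & J = [set a | I (a * y)]) [set a | I (a * 1)].
- by move=> _ [y _ ->].
- by exists 1.
exists y => //; split=> //=; first by rewrite mul1r.
move=> a b _ _ Iaby; apply: contrapT => /not_orP[nIa nIb]; apply: nIa.
apply: (ymax [set c | I (c * (b * y))]) => //=; last by rewrite mulrA.
  by exists (b * y).
by move=> c Ic; rewrite /= mulrCA; apply: idealMl.
Qed.

(* If R is the only prime between I and R then D_R / I D_R is artinian. *)
Lemma saturated_dcc R I (J : nat -> set D) : prime_ideal [set: D] R ->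
  (forall P, prime_ideal [set: D] P -> I `<=` P -> P `<=` R -> R `<=` P) ->
  (forall n, [/\ ideal [set: D] (J n), saturated R (J n), I `<=` J n & J n.+1 `<=` J n]) ->
  exists n, J n `<=` J n.+1.
Proof.
move=> pR Rmin JP.
suff: exists N, forall n, (N <= n)%N -> J N `<=` J n.
  by move=> [N NP]; exists N; apply: NP.
move: J JP; pose dcc M := forall J : nat -> set D, (forall n, [/\ ideal [set: D] (J n),
  saturated R (J n), M `<=` J n & J n.+1 `<=` J n]) ->
  exists N, forall n, (N <= n)%N -> J N `<=` J n.
suff : dcc (saturation R (ideal_gen I)).
  move=> + J JP; apply => n; have [iJ sJ IJ JS] := JP n; split=> //.
  by apply: saturation_sub => //; apply: ideal_gen_sub.
apply: contrapT => ndcc.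
(* Noetherian induction: above [M] some chain does not stabilize, but above every larger saturated
   ideal all do. *)
have [||M [iM sM IM ndM] Mmax] := @noetherian_max
  (fun M => [/\ ideal [set: D] M, saturated R M, I `<=` M & ~ dcc M])
  (saturation R (ideal_gen I)).
- by move=> M [].
- split=> //; [exact/ideal_saturation/ideal_ideal_gen|exact: saturated_saturation|].
  by move=> x Ix; apply: sub_saturation => //; apply: sub_ideal_gen.
have M1 : ~ M 1.
  move=> M1; apply: ndM => J JP; exists 0%N => n _ x _; have [iJ _ MJ _] := JP n.
  by rewrite -[x]mulr1; apply: idealMl => //; apply: MJ.
have [y My pcol] := prime_colon iM M1.
(* The colon prime contains [I] and lies in [R], so it is [R]: modulo [M], the element [y] spans a
   simple D_R-module. *)
have RyM : forall a, R a -> M (a * y).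
  apply: (Rmin [set a | M (a * y)]) => //.
    by move=> a Ia /=; apply: idealMr => //; apply: IM.
  by apply: saturated_proper; rewrite /= ?mul1r // => s a Rs /=; rewrite -mulrA; apply: sM.
pose M' (N : set D) := saturation R (ideal_gen (y |` N)).
have MM' N : N `<=` M' N.
  by move=> x Nx; apply: sub_saturation => //; apply: sub_ideal_gen; right.
have dccM' : dcc (M' M).
  apply: contrapT => nd; apply: My; apply: (Mmax (M' M)).
  - split=> //; [exact/ideal_saturation/ideal_ideal_gen|exact: saturated_saturation|].
    by apply: subset_trans IM _; apply: MM'.
  - exact: MM'.
  - by apply: sub_saturation => //; apply: sub_ideal_gen; left.
apply: ndM => J JP.
have Jdec n k : J (n + k)%N `<=` J n.
  elim: k => [|k IH]; first by rewrite addn0.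
  by rewrite addnS; apply: subset_trans IH; case: (JP (n + k)%N).
have M'mono N N' : N `<=` N' -> M' N `<=` M' N'.
  move=> NN'; apply: saturation_sub; first exact: saturated_saturation.
  apply: ideal_gen_sub; first exact/ideal_saturation/ideal_ideal_gen.
  move=> z zN; apply: sub_saturation => //; apply: sub_ideal_gen.
  by case: zN => [->|/NN']; [left|right].
have [n0 n0P] : exists N, forall n, (N <= n)%N -> M' (J N) `<=` M' (J n).
  apply: dccM' => n; have [_ _ MJ JS] := JP n; split.
  - exact/ideal_saturation/ideal_ideal_gen.
  - exact: saturated_saturation.
  - exact: M'mono.
  - exact: M'mono.
(* With [y] adjoined, the chain is constant from [n0] on. If every [J n] contains [y], adjoining it
   changes nothing. *)
have [allJy|] := pselect (forall n, J n y).
  exists n0 => n n0n x /MM'/(n0P n n0n); have [iJ sJ _ _] := JP n.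
  apply: saturation_sub => //; apply: ideal_gen_sub => // _ [->|//]; exact: allJy.
(* If [J n1] misses [y], then in [s * z = w + c * y] the factor [c] must be in [R], as otherwise [y]
   would be in [J n1]; hence [c * y] is in [M]. *)
move=> /existsNP[n1 Jy]; exists (n0 + n1)%N => n n01n z Jz.
have Jz0 : J n0 z by apply: Jdec Jz.
have [iJ sJ MJ _] := JP n.
have n0n : (n0 <= n)%N by apply: leq_trans n01n; apply: leq_addr.
have [s Rs /(ideal_gen_idU1 iJ)[w Jw [c E]]] := n0P n n0n z (MM' _ _ Jz0).
apply: (sJ s) => //; rewrite E; apply: (idealD iJ) => //; apply: MJ; apply: RyM.
apply: contrapT => Rc; apply: Jy; rewrite addnC in Jz.
have [iJ1 sJ1 _ _] := JP n1; apply: (sJ1 c) => //.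
apply: (ideal_addKl iJ1 (x := w)); first by rewrite -E; apply: idealMl => //; apply: Jdec Jz.
by move: Jw; rewrite -(subnKC n01n) -addnA addnCA; apply: Jdec.
Qed.

End Noetherian.

(** * Heights of primes *)

Section Chains.
Variable D : comNzRingType.
Implicit Types I J P Q R S : set D.

Lemma primeX P x n : prime_ideal [set: D] P -> P (x ^+ n) -> P x.
Proof.
move=> pP; elim: n => [|n IH]; first by rewrite expr0; case: pP => _ nP1 _ /nP1.
by rewrite exprS => /(primeM pP)[].
Qed.

(** Chains of [n] strict steps, unfolded from the bottom because the later inductions modify or
    remove the second member. That [P] is prime is stated separately. *)
Fixpoint prime_path n P R : Prop :=
  if n is n'.+1 then exists Q, [/\ prime_ideal [set: D] Q, P `<` Q & prime_path n' Q R]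
  else P = R.

Lemma prime_path_sub n P R : prime_path n P R -> P `<=` R.
Proof.
elim: n P => [P ->//|n IH P [Q [_ PQ /IH QR]]].
exact: subset_trans (properW PQ) QR.
Qed.

Lemma prime_path_proper n P R : prime_path n.+1 P R -> P `<` R.
Proof.
move=> [Q [_ [PQ nQP] /prime_path_sub QR]]; split; first exact: subset_trans PQ QR.
by move=> RP; apply: nQP; apply: subset_trans QR RP.
Qed.

Lemma prime_path_prime n P R : prime_ideal [set: D] P -> prime_path n P R ->
  prime_ideal [set: D] R.
Proof. by elim: n P => [P pP <-//|n IH P _ [Q [pQ _ /(IH Q pQ)]]]. Qed.

Lemma prime_path_rcons n P Q R : prime_ideal [set: D] R ->
  prime_path n P Q -> Q `<` R -> prime_path n.+1 P R.
Proof.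
move=> pR; elim: n P => [P -> QR|n IH P [P1 [pP1 PP1 P1Q]] QR]; first by exists R.
by exists P1; split=> //; apply: IH.
Qed.

Lemma prime_pathP n P R : prime_ideal [set: D] P -> prime_path n P R <->
  exists f : nat -> set D, [/\ f 0%N = P, f n = R,
    forall i, (i <= n)%N -> prime_ideal [set: D] (f i)
    & forall i, (i < n)%N -> f i `<` f i.+1].
Proof.
elim: n P => [|n IH] P pP /=.
  by split=> [<-|[f [<- <- _ _]]//]; exists (fun=> P).
split=> [[Q [pQ PQ /(IH _ pQ)[f [f0 fn fp fS]]]]|[f [f0 fn fp fS]]].
  exists (fun i => if i is j.+1 then f j else P); split=> //; first by case.
  by case=> [_|i]; [rewrite f0|apply: fS].
exists (f 1%N); split; [exact: fp|by rewrite -f0; apply: fS|].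
apply/IH; first exact: fp.
by exists (fun i => f i.+1); split=> // i; [apply: (fp i.+1)|apply: (fS i.+1)].
Qed.

Hypothesis noethD : noetherian [set: D].

(* Krull's principal ideal theorem: otherwise R is the only prime between
   P + (x) and R, so the sets [q^n D_Q + P D_Q] with [q] in Q but not in P,
   contracted to D_R, stabilize modulo x, hence stabilize by Nakayama. *)
Lemma principal_ideal_theorem P Q R x :
  prime_ideal [set: D] P -> prime_ideal [set: D] Q -> prime_ideal [set: D] R ->
  P `<` Q -> Q `<` R -> R x ->
  exists Q', [/\ prime_ideal [set: D] Q', Q' x, P `<` Q' & Q' `<` R].
Proof.
move=> pP pQ pR PQ QR Rx; apply: contrapT => noQ'.
have [[iP iQ] iR] := (prime_ideal_ideal pP, prime_ideal_ideal pQ, prime_ideal_ideal pR).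
have nQx : ~ Q x by move=> Qx; apply: noQ'; exists Q; split.
have nPx : ~ P x by move=> /(properW PQ)/nQx.
have [q [Qq nPq]] : exists q, Q q /\ ~ P q.
  apply: contrapT => nq; case: PQ => _; apply=> q Qq; apply: contrapT => nPq.
  by apply: nq; exists q.
pose I n := saturation Q (ideal_gen (q ^+ n |` P)).
pose J n := saturation R (ideal_gen (x |` I n)).
have iI n : ideal [set: D] (I n) by apply/ideal_saturation/ideal_ideal_gen.
have sI n : saturated Q (I n) by apply: saturated_saturation.
have sIR n : saturated R (I n).
  by move=> s y nRs; apply: sI => /(properW QR).
have PI n : P `<=` I n.
  by move=> y Py; apply: sub_saturation => //; apply: sub_ideal_gen; right.
have qI n : I n (q ^+ n) by apply: sub_saturation => //; apply: sub_ideal_gen; left.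
have II n : I n.+1 `<=` I n.
  apply: saturation_sub => //; apply: ideal_gen_sub => // _ [->|/PI//].
  by rewrite exprS; apply: idealMl.
have IJ n : I n `<=` J n.
  by move=> y Iy; apply: sub_saturation => //; apply: sub_ideal_gen; right.
have xJ n : J n x by apply: sub_saturation => //; apply: sub_ideal_gen; left.
have iJ n : ideal [set: D] (J n) by apply/ideal_saturation/ideal_ideal_gen.
have sJ n : saturated R (J n) by apply: saturated_saturation.
(* A prime below [R], other than [R], containing [P] and [x] would be the [Q'] sought, so
   [saturated_dcc] applies. *)
have [n JJ] : exists n, J n `<=` J n.+1.
  apply: (saturated_dcc noethD (I := x |` P) pR) => [Q' pQ' xPQ' Q'R|n].
    apply: contrapT => nRQ'; apply: noQ'; exists Q'; split=> //.
      by apply: xPQ'; left.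
    split=> [y Py|/(_ x)]; first by apply: xPQ'; right.
    by move=> Q'P; apply/nPx/Q'P/xPQ'; left.
  split=> //; first by move=> y [->|Py]; [exact: xJ|exact/IJ/PI].
  apply: saturation_sub => //; apply: ideal_gen_sub => // y [->|Iy]; [exact: xJ|exact/IJ/II].
(* As [x] is outside [Q], having [c * x] in [I n] forces [c] into [I n]; so locally at [R], [I n]
   lies in the sum of [I n.+1] and x times [I n]. *)
have : I n `<=` I n.+1.
  apply: (nakayama noethD pR (iI n.+1) (sIR n.+1) Rx) => z Iz.
  have [s nRs /(ideal_gen_idU1 (iI n.+1))[w Iw [c E]]] := JJ z (IJ n z Iz).
  exists s => //; exists w => //; exists c; last by rewrite E mulrC.
  apply: (sI n x) => //; apply: (ideal_addKl (iI n) (x := w)); last exact: II.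
  by rewrite (mulrC x) -E; apply: idealMl.
(* Here [s * q ^+ n = w + c * q ^+ n.+1] with [w] in [P], so [P] contains [s - c * q] or [q]. The
   former would put [s] into [Q]. *)
move=> /(_ _ (qI n)) [s nQs /(ideal_gen_idU1 iP)[w Pw [c E]]].
apply: nQs; have /(primeM pP)[/(properW PQ) Qscq|/(primeX pP)//] : P ((s - c * q) * q ^+ n).
  by rewrite mulrBl E -mulrA -exprS addrK.
by rewrite -(subrK (c * q) s); apply: (idealD iQ) => //; apply: idealMl.
Qed.

(** The path is bent from the top down: once the member after [Q] contains [x], the principal ideal
    theorem exchanges [Q] for a prime containing [x]. *)
Lemma prime_path_move n P R x : prime_ideal [set: D] P ->
  prime_path n.+1 P R -> R x ->
  exists P1, [/\ prime_ideal [set: D] P1, P1 x, P `<` P1 & prime_path n P1 R].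
Proof.
move=> + + Rx; elim: n P => [|n IH] P pP [Q [pQ PQ QR]].
  by exists Q; split=> //; move: QR => /= ->.
have [Q1 [pQ1 Q1x QQ1 Q1R]] := IH Q pQ QR.
have [Q' [pQ' Q'x PQ' Q'Q1]] := principal_ideal_theorem pP pQ pQ1 PQ QQ1 Q1x.
by exists Q'; split=> //; exists Q1.
Qed.

(** Bending the path so that its second member contains the first element of [xs] leaves a path
    shorter by one and a list shorter by one. *)
Lemma height_theorem (xs : seq D) n P R : prime_ideal [set: D] P ->
  (forall x, x \in xs -> R x) ->
  (forall Q, prime_ideal [set: D] Q -> P `<=` Q -> (forall x, x \in xs -> Q x) ->
    Q `<=` R -> R `<=` Q) ->
  prime_path n P R -> (n <= size xs)%N.
Proof.
elim: xs n P => [|x xs IH] [|n] P pP xsR Rmin // PR.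
  by have [PR1 RP] := prime_path_proper PR; case: RP; apply: Rmin.
have [|P1 [pP1 P1x PP1 P1R]] := prime_path_move (x := x) pP PR.
  by apply: xsR; rewrite inE eqxx.
apply: (IH n P1) => // [y yxs|Q pQ P1Q xsQ QR]; first by apply: xsR; rewrite inE yxs orbT.
apply: Rmin => //; first exact: subset_trans (properW PP1) P1Q.
by move=> y; rewrite inE => /orP[/eqP->|/xsQ//]; apply: P1Q.
Qed.

(* Regular local rings are domains: here [R D_R] is generated modulo the
   elements of S by as many elements as the length of a path from J. *)
Lemma regular_prime (xs : seq D) S J R :
  prime_ideal [set: D] J -> S `<=` J -> (forall x, x \in xs -> R x) ->
  R `<=` saturation R (ideal_gen (S `|` [set` xs])) ->
  prime_path (size xs) J R -> J `<=` saturation R (ideal_gen S).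
Proof.
elim: xs S J => [|x xs IH] S J pJ SJ xsR Rgen JR.
  suff <- : S `|` [set` [::]] = S by move: JR => ->.
  by apply/seteqP; split=> y; [case|left].
have Rx : R x by apply: xsR; rewrite inE eqxx.
have xsR' y : y \in xs -> R y by move=> yxs; apply: xsR; rewrite inE yxs orbT.
have [J1 [pJ1 J1x JJ1 J1R]] := prime_path_move pJ JR Rx.
have [pR iJ] := (prime_path_prime pJ JR, prime_ideal_ideal pJ).
(* Otherwise [R] would be minimal over [J] and [xs], and the path would be too long for the height
   theorem. *)
have nJx : ~ J x.
  move=> Jx; suff : (size (x :: xs) <= size xs)%N by rewrite ltnn.
  apply: (height_theorem pJ xsR' _ JR) => Q pQ JQ xsQ QR.
  apply: subset_trans Rgen _; apply: saturation_sub; first exact: prime_saturated.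
  apply: ideal_gen_sub; first exact: prime_ideal_ideal.
  move=> y [/SJ/JQ//|/=]; rewrite inE => /orP[/eqP->|]; [exact: JQ|exact: xsQ].
have J1gen : J1 `<=` saturation R (ideal_gen (x |` S)).
  apply: IH => //.
    by move=> y [->//|/SJ/(properW JJ1)].
  suff -> : x |` S `|` [set` xs] = S `|` [set` x :: xs] by [].
  apply/seteqP; split=> y /=.
    by rewrite inE; case=> [[->|]|]; [right; rewrite eqxx|left|move=> ->; right; rewrite orbT].
  by rewrite inE; case=> [|/orP[/eqP->|]]; [left; right|left; left|right].
(* In [s * z = w + c * x] the product [c * x] lies in [J] while [x] does not, so [c] does: locally,
   [J] lies in (S) + x J. *)
apply: (nakayama noethD pR _ _ Rx).
- exact/ideal_saturation/ideal_ideal_gen.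
- exact: saturated_saturation.
move=> z Jz; have [s nRs /ideal_genU1[w Sw [c E]]] := J1gen z (properW JJ1 Jz).
exists s => //; exists w; first exact: sub_saturation.
exists c; last by rewrite E mulrC.
have /(primeM pJ)[//|/nJx//] : J (c * x).
apply: (ideal_addKl iJ (x := w)); first by rewrite -E; apply: idealMl.
exact: ideal_gen_sub Sw.
Qed.

End Chains.

(** * Hilbert's basis theorem *)

Section Subring.
Variables (L : comNzRingType) (A : set L).
Hypothesis sA : subring A.

Lemma subring1 : A 1.
Proof. by case: sA => /asboolP. Qed.

Lemma subringB x y : A x -> A y -> A (x - y).
Proof. by case: sA => _ AB _ Ax Ay; apply/asboolP/AB; apply/asboolP. Qed.

Lemma subringM x y : A x -> A y -> A (x * y).
Proof. by case: sA => _ _ AM Ax Ay; apply/asboolP/AM; apply/asboolP. Qed.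

Lemma subring0 : A 0.
Proof. by rewrite -(subrr 1); apply: subringB; apply: subring1. Qed.

Lemma subringN x : A x -> A (- x).
Proof. by rewrite -sub0r; apply: subringB; apply: subring0. Qed.

Lemma subringD x y : A x -> A y -> A (x + y).
Proof. by move=> Ax Ay; rewrite -[y]opprK; apply: subringB => //; apply: subringN. Qed.

Lemma subring_sum (T : Type) (r : seq T) (p : pred T) (f : T -> L) :
  (forall i, p i -> A (f i)) -> A (\sum_(i <- r | p i) f i).
Proof.
by move=> Af; elim/big_ind: _ => //; [apply: subring0|apply: subringD].
Qed.

Lemma subringX x n : A x -> A (x ^+ n).
Proof.
move=> Ax; elim: n => [|n IH]; first by rewrite expr0; apply: subring1.
by rewrite exprS; apply: subringM.
Qed.

Lemma subring_nat n : A n%:R.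
Proof.
elim: n => [|n IH]; first exact: subring0.
by rewrite mulrS; apply: subringD => //; apply: subring1.
Qed.

Section Span.
Variables (n : nat) (g : 'I_n -> L).

Lemma ideal_span0 : ideal_span A g 0.
Proof.
exists (fun=> 0); first by move=> _; apply: subring0.
by rewrite big1 // => i _; rewrite mul0r.
Qed.

Lemma ideal_spanD x y : ideal_span A g x -> ideal_span A g y -> ideal_span A g (x + y).
Proof.
move=> [a Aa ->] [b Ab ->]; exists (fun i => a i + b i).
  by move=> i; apply: subringD.
by rewrite -big_split; apply: eq_bigr => i _; rewrite mulrDl.
Qed.

Lemma ideal_spanM a x : A a -> ideal_span A g x -> ideal_span A g (a * x).
Proof.
move=> Aa [b Ab ->]; exists (fun i => a * b i).
  by move=> i; apply: subringM.
by rewrite big_distrr /=; apply: eq_bigr => i _; rewrite mulrA.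
Qed.

Lemma mem_ideal_span i : ideal_span A g (g i).
Proof.
exists (fun j => (j == i)%:R).
  by move=> j; case: eqP => _; [apply: subring1|apply: subring0].
by rewrite (bigD1 i) //= eqxx mul1r big1 ?addr0 // => j /negPf->; rewrite mul0r.
Qed.

Lemma ideal_span_sub I : ideal A I -> (forall i, I (g i)) -> ideal_span A g `<=` I.
Proof.
move=> iI Ig x [a Aa ->]; elim/big_ind: _ => //; first exact: (ideal0 iI).
  exact: (idealD iI).
by move=> i _; apply: (idealM iI).
Qed.

End Span.
End Subring.

Lemma subring_setT (L : comNzRingType) : subring [set: L].
Proof. by split=> [|x y _ _|x y _ _]; apply/asboolP. Qed.

Lemma ideal_ideal_span (L : comNzRingType) n (g : 'I_n -> L) :
  ideal [set: L] (ideal_span [set: L] g).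
Proof.
by split=> // *; [apply: ideal_span0|apply: ideal_spanD|apply: ideal_spanM];
  try exact: subring_setT.
Qed.

Lemma size_leq_coef0 (A : nzRingType) (p : {poly A}) n :
  (size p <= n.+1)%N -> p`_n = 0 -> (size p <= n)%N.
Proof.
move=> szp pn0; apply/leq_sizeP => j; rewrite leq_eqVlt => /orP[/eqP<-//|nj].
by apply: nth_default; apply: leq_trans nj.
Qed.

Lemma hilbert_basis (A : comNzRingType) :
  noetherian [set: A] -> noetherian [set: {poly A}].
Proof.
move=> noethA I iI.
(* The size bound allows a zero coefficient in degree [n], which makes [lead n] an ideal; these
   ideals increase with [n], hence are constant from some [N] on. *)
pose lead n := [set a : A | exists2 p, I p & (size p <= n.+1)%N /\ p`_n = a].
have ilead n : ideal [set: A] (lead n).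
  split=> //; first by exists 0; [apply: (ideal0 iI)|rewrite size_poly0 coef0].
  - move=> _ _ [p Ip [szp <-]] [q Iq [szq <-]]; exists (p + q).
      exact: (idealD iI).
    by rewrite coefD; split=> //; rewrite (leq_trans (size_polyD p q)) // geq_max szp.
  - move=> a _ _ [p Ip [szp <-]]; exists (a%:P * p); first exact: idealMl.
    by rewrite coefCM mul_polyC; split=> //; rewrite (leq_trans (size_scale_leq a p)).
have leadS n k : lead n `<=` lead (n + k)%N.
  elim: k => [|k IH]; first by rewrite addn0.
  rewrite addnS => a /IH[p Ip [szp <-]]; exists (p * 'X); first exact: idealMr.
  by rewrite coefMX /=; split=> //; rewrite (leq_trans (size_polyMleq _ _)) // size_polyX addn2.
have [N leadN] : exists N, forall n, lead n `<=` lead N.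
  have iU : ideal [set: A] [set a | exists n, lead n a].
    split=> //; first by exists 0%N; apply: (ideal0 (ilead _)).
      move=> x y [k sx] [n sy]; exists (k + n)%N; apply: (idealD (ilead _)).
        exact: leadS.
      by rewrite addnC; apply: leadS.
    by move=> a x _ [k sx]; exists k; apply: idealMl.
  have [m [g Ug]] := noethA _ iU.
  have /choice[f fP] : forall i, exists k, lead k (g i).
    move=> i; suff : [set a | exists n, lead n a] (g i) by [].
    by rewrite Ug; apply: mem_ideal_span; apply: subring_setT.
  exists (\sum_i f i)%N => n a an; have : [set a | exists n, lead n a] a by exists n.
  rewrite Ug; apply: ideal_span_sub => // i.
  by rewrite (bigD1 i) //=; apply: leadS.
(* A list of level [n] lowers the degree of members of degree [n]. A list serving all levels
   generates [I], by induction on the size. *)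
pose level n (s : seq {poly A}) := (forall p, p \in s -> I p) /\ forall p, I p ->
  (size p <= n.+1)%N -> exists2 q, ideal_gen [set` s] q & (size (p - q)%R <= n)%N.
have /choice[s sP] : forall n, exists s, level n s.
  move=> n; have [m [g leadg]] := noethA _ (ilead n).
  have /choice[f fP] : forall i, exists p, I p /\ (size p <= n.+1)%N /\ p`_n = g i.
    move=> i; suff : lead n (g i) by case=> p; exists p.
    by rewrite leadg; apply: mem_ideal_span; apply: subring_setT.
  exists (codom f); split=> [p /codomP[i ->]|p Ip szp]; first by case: (fP i).
  have : lead n p`_n by exists p.
  rewrite leadg => -[a _ pa]; exists (\sum_i (a i)%:P * f i).
    have igen := ideal_ideal_gen [set` codom f].
    apply: ideal_sum => [|i _]; first exact: igen.
    apply: (idealMl _ igen).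
    by apply: sub_ideal_gen => /=; apply: codom_f.
  apply: size_leq_coef0; last first.
    rewrite coefB coef_sum pa; apply/eqP; rewrite subr_eq0; apply/eqP.
    by apply: eq_bigr => i _; rewrite coefCM; case: (fP i) => _ [_ ->].
  rewrite (leq_trans (size_polyD _ _)) // geq_max szp size_polyN.
  apply: (leq_trans (size_sum _ _ _)); apply/bigmax_leqP => i _.
  by rewrite mul_polyC (leq_trans (size_scale_leq _ _)) //; case: (fP i) => _ [].
pose S := flatten [seq s k | k <- iota 0 N.+1].
have Ss k : (k <= N)%N -> ideal_gen [set` s k] `<=` ideal_gen [set` S].
  move=> kN; apply: ideal_gen_sub; first exact: ideal_ideal_gen.
  move=> p /= ps; apply: sub_ideal_gen => /=; apply/flatten_mapP; exists k => //.
  by rewrite mem_iota.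
have igenS := ideal_ideal_gen [set` S].
have levelS n : level n S.
  split=> [p /flatten_mapP[k _]|p Ip szp]; first by case: (sP k) => + _; apply.
  have [nN|Nn] := leqP n N.
    by have [_ /(_ p Ip szp)[q /(Ss n nN) Sq]] := sP n; exists q.
  (* Above [N] the coefficient to be cancelled already occurs in degree [N]; the combination found
     there is shifted by a power of the variable. *)
  have [|p' Ip' [szp' p'N]] := leadN n p`_n; first by exists p.
  have [_ /(_ p' Ip' szp')[q sq szpq]] := sP N.
  have szq : (size q <= N.+1)%N.
    rewrite -[q](subKr p') (leq_trans (size_polyD _ _)) // geq_max szp' size_polyN.
    exact: leqW.
  have qN : q`_N = p`_n.
    by rewrite -p'N -[q](subKr p') coefB [X in _ - X]nth_default ?subr0.
  exists (q * 'X^(n - N)); first by apply: (idealMr _ igenS); apply: (Ss N).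
  have szqX : (size (q * 'X^(n - N))%R <= n.+1)%N.
    rewrite (leq_trans (size_polyMleq _ _)) // size_polyXn addnS /=.
    by rewrite -(subnKC (ltnW Nn)) -addSn addKn leq_add2r.
  apply: size_leq_coef0.
    by rewrite (leq_trans (size_polyD _ _)) // geq_max szp size_polyN.
  by rewrite coefB coefMXn ltnNge leq_subr subKn ?qN ?subrr // ltnW.
have genS n p : I p -> (size p <= n)%N -> ideal_gen [set` S] p.
  elim: n p => [|n IH] p Ip szp.
    by move: szp; rewrite leqn0 size_poly_eq0 => /eqP->; apply: (ideal0 igenS).
  have [SI /(_ p Ip szp)[q Sq szpq]] := levelS n.
  rewrite -(subrK q p); apply: (idealD igenS) => //; apply: IH => //.
  by apply: idealB => //; apply: ideal_gen_sub Sq.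
exists (size S), (fun i => tnth (in_tuple S) i); apply/seteqP; split.
  move=> p Ip; have := genS _ p Ip (leqnn _); apply: ideal_gen_sub.
    exact: ideal_ideal_span.
  move=> q /= qS; have /tnthP[i ->] : q \in in_tuple S by [].
  by apply: mem_ideal_span; apply: subring_setT.
by apply: ideal_span_sub => // i; case: (levelS 0%N) => + _; apply; apply: mem_tnth.
Qed.

(** * Indexed chains of primes versus paths *)

Section PrimeChain.
Variable D : comNzRingType.
Implicit Types P R : set D.

Lemma prime_chain_path n (P : 'I_n.+1 -> set D) :
  prime_chain [set: D] P -> prime_path n (P ord0) (P ord_max).
Proof.
move=> [pP lP]; apply/prime_pathP; first exact: pP.
exists (fun i => P (inord i)); split=> [|||i ilt]; last 1 first.
- by apply: lP; rewrite !inordK // ltnW.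
- by congr P; apply: val_inj; rewrite /= inordK.
- by congr P; apply: val_inj; rewrite /= inordK.
- by move=> i _; apply: pP.
Qed.

Lemma prime_path_chain n P R : prime_ideal [set: D] P -> prime_path n P R ->
  exists f : 'I_n.+1 -> set D, [/\ prime_chain [set: D] f, f ord0 = P & f ord_max = R].
Proof.
move=> pP /(prime_pathP _ _ pP)[f [f0 fn fp fS]].
exists (fun i => f i); split=> //; split=> [i|i j ij]; first by apply: fp; rewrite -ltnS.
have : forall k, (i + k.+1 <= n)%N -> f i `<` f (i + k.+1)%N.
  elim=> [|k IH] ikn; first by rewrite addn1; apply: fS; rewrite -[i.+1]addn1.
  have /IH[ff nff] : (i + k.+1 <= n)%N by lia.
  rewrite addnS; have [ff' nff'] : f (i + k.+1)%N `<` f (i + k.+1).+1 by apply: fS; lia.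
  split; first exact: subset_trans ff'.
  by move=> /(subset_trans ff').
move=> /(_ (j - i).-1); rewrite prednK ?subn_gt0 // subnKC; last exact: ltnW.
by apply; rewrite -ltnS.
Qed.

Lemma prime_chain_sub n (P : 'I_n.+1 -> set D) : prime_chain [set: D] P ->
  forall i, P ord0 `<=` P i /\ P i `<=` P ord_max.
Proof.
move=> [_ lP] i; split.
  have [->//|i0] := eqVneq i ord0.
  by apply: properW; apply: lP; rewrite lt0n.
have [->//|im] := eqVneq i ord_max.
apply: properW; apply: lP; rewrite ltn_neqAle -ltnS ltn_ord andbT.
by apply: contra im => /eqP E; apply/eqP/val_inj.
Qed.

End PrimeChain.

(** * Extending primes to the polynomial ring *)

Section PolyExtension.
Variable A : comNzRingType.
Implicit Types P R : set A.

Definition poly_ideal P : set {poly A} := [set f | forall i, P f`_i].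

Lemma ideal_poly_ideal P : ideal [set: A] P -> ideal [set: {poly A}] (poly_ideal P).
Proof.
move=> iP; split=> //; first by move=> i; rewrite coef0; apply: (ideal0 iP).
  by move=> f g Pf Pg i; rewrite coefD; apply: (idealD iP).
by move=> f g _ Pg i; rewrite coefM; apply: ideal_sum => // j _; apply: idealMl.
Qed.

Lemma poly_idealC P a : ideal [set: A] P -> poly_ideal P a%:P <-> P a.
Proof.
move=> iP; split=> [/(_ 0%N)|Pa [|i]]; rewrite coefC //=; exact: (ideal0 iP).
Qed.

(** Gauss's lemma: if [i] and [j] are the lowest indices of coefficients outside [P], the
    coefficient of index [i + j] of the product is [f]_i * g[_j] modulo [P]. *)
Lemma prime_poly_ideal P : prime_ideal [set: A] P ->
  prime_ideal [set: {poly A}] (poly_ideal P).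
Proof.
move=> pP; have iP := prime_ideal_ideal pP; have iPX := ideal_poly_ideal iP.
split=> //; first by move/(poly_idealC _ iP); case: pP.
move=> f g _ _ Pfg; apply: contrapT => /not_orP[].
have minc (k : {poly A}) : ~ poly_ideal P k -> exists2 i, ~ P k`_i & forall j, (j < i)%N -> P k`_j.
  move=> /existsNP nPk; have exk : exists i, `[< ~ P k`_i >].
    by case: nPk => i ?; exists i; apply/asboolP.
  case: (ex_minnP exk) => i /asboolP nPi imin; exists i => // j ji.
  by apply: contrapT => /asboolP/imin; rewrite leqNgt ji.
move=> /minc[i nPi Pi] /minc[j nPj Pj].
have iij : (i < (i + j).+1)%N by rewrite ltnS leq_addr.
have := Pfg (i + j)%N; rewrite coefM (bigD1 (Ordinal iij)) //= addrC addKn => Psum.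
suff /(primeM pP)[] : P (f`_i * g`_j) by [].
apply: (ideal_addKl iP Psum); apply: ideal_sum => // k /eqP ki.
have [/Pi Pk|ik] := ltnP k i; first exact: idealMr.
apply: idealMl => //; apply: Pj; suff : (i <> k :> nat) by have := ltn_ord k; lia.
by move=> ik'; apply: ki; apply: val_inj.
Qed.

Lemma poly_ideal_proper P R : ideal [set: A] P -> ideal [set: A] R ->
  P `<` R -> poly_ideal P `<` poly_ideal R.
Proof.
move=> iP iR [PR nRP]; split=> [f Pf i|RPX]; first exact: PR.
by apply: nRP => a Ra; apply/(poly_idealC _ iP)/RPX/(poly_idealC _ iR).
Qed.

Lemma prime_path_poly n P R : prime_ideal [set: A] P -> prime_path n P R ->
  prime_path n (poly_ideal P) (poly_ideal R).
Proof.
elim: n P => [P _ ->//|n IH P pP [Q [pQ PQ QR]]].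
exists (poly_ideal Q); split; [exact: prime_poly_ideal| |exact: IH].
by apply: poly_ideal_proper => //; apply: prime_ideal_ideal.
Qed.

End PolyExtension.

(** * Local rings and domination by a valuation ring *)

Section LocalRing.
Variables (L : comNzRingType) (A M : set L).
Hypotheses (sA : subring A) (iM : ideal A M) (M1 : ~ M 1).
Hypothesis unitA : forall x, A x -> ~ M x -> exists2 y, A y & x * y = 1.

Lemma proper_ideal_sub I : ideal A I -> ~ I 1 -> I `<=` M.
Proof.
move=> iI I1 x Ix; apply: contrapT => Mx; apply: I1.
have [y Ay <-] := unitA (ideal_sub iI Ix) Mx.
by rewrite mulrC; apply: (idealM iI).
Qed.

Lemma units_local_ring : local_ring A M.
Proof.
split=> [|M' [iM' M'1 maxM']].
  split=> // I iI I1 MI; apply/seteqP; split=> //; exact: proper_ideal_sub.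
by apply/esym/maxM' => //; apply: proper_ideal_sub.
Qed.

Lemma units_prime_ideal : prime_ideal A M.
Proof.
split=> // x y Ax Ay Mxy; apply: contrapT => /not_orP[Mx]; apply.
have [z Az xz] := unitA Ax Mx.
have -> : y = z * (x * y) by rewrite mulrA (mulrC z) xz mul1r.
exact: (idealM iM).
Qed.

End LocalRing.

Section DominatedLocalRing.
Variables (F : fieldType) (O m : set F).
Hypotheses (im : ideal O m) (m1 : ~ m 1).

Lemma notin_ideal_neq0 x : ~ m x -> x != 0.
Proof. by move=> mx; apply/eqP => x0; apply: mx; rewrite x0; apply: (ideal0 im). Qed.

Lemma local_unitO : (forall x, O x -> ~ m x -> O x^-1) ->
  forall x, O x -> ~ m x -> exists2 y, O y & x * y = 1.
Proof.
move=> unitO x Ox mx; exists x^-1; first exact: unitO.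
by rewrite divff // notin_ideal_neq0.
Qed.

Lemma dominated_local_ring B : subring B -> B `<=` O ->
  (forall y, B y -> ~ m y -> B y^-1) -> local_ring B (B `&` m).
Proof.
move=> sB BO Binv; apply: units_local_ring => //.
- split=> [y []//||y z [By my] [Bz mz]|a y Ba [By my]]; split=> //.
  + exact: subring0.
  + exact: (ideal0 im).
  + exact: subringD.
  + exact: (idealD im).
  + exact: subringM.
  + by apply: (idealM im) => //; apply: BO.
- by case.
- move=> y By mBy; have my : ~ m y by move=> my; apply: mBy.
  by exists y^-1; [apply: Binv|rewrite divff // notin_ideal_neq0].
Qed.

End DominatedLocalRing.

(** * Simple etale extensions of regular local rings *)

Section Etale.
Variables (A : comNzRingType) (F : fieldType) (iota : {rmorphism A -> F}).
Variables (O m : set F).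
Hypotheses (iota_inj : injective iota) (sO : subring O) (im : ideal O m) (m1 : ~ m 1).
Hypothesis unitO : forall x, O x -> ~ m x -> O x^-1.
Hypothesis iotaO : forall a, O (iota a).
Hypothesis unitA : forall a, ~ m (iota a) -> exists b, a * b = 1.
Variables (eta : F) (h : {poly A}).
Hypothesis Oeta : O eta.

(** [A] is a type with an embedding [iota], rather than a subset of [F], so that the polynomial ring
    over it is available. *)
Definition eval_at : {poly A} -> F := horner_morph (fun a => mulrC eta (iota a)).
HB.instance Definition _ := GRing.RMorphism.on eval_at.

Hypotheses (h0 : eval_at h = 0) (h'm : ~ m (eval_at h^`())).

Lemma eval_atE f : eval_at f = (map_poly iota f).[eta].
Proof. by []. Qed.

Lemma eval_atC a : eval_at a%:P = iota a.
Proof. exact: horner_morphC. Qed.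

Lemma eval_atX : eval_at 'X = eta.
Proof. exact: horner_morphX. Qed.

(** The ring to be studied is A[X]_Q modulo the kernel [I]; [m0] is the extension to A[X] of the
    maximal ideal of [A]. *)
Let Q : set {poly A} := [set f | m (eval_at f)].
Let I : set {poly A} := [set f | eval_at f = 0].
Let m0 : set {poly A} := poly_ideal [set a | m (iota a)].

Let m_0 : m 0. Proof. exact: (ideal0 im). Qed.

Lemma eval_atO f : O (eval_at f).
Proof.
elim/poly_ind: f => [|f a IH]; first by rewrite rmorph0; apply: subring0.
by rewrite rmorphD rmorphM /= eval_atC eval_atX; apply: subringD => //; apply: subringM.
Qed.

Lemma prime_eval_at (J : set {poly A}) (P : set F) : prime_ideal O P ->
  J = [set f | P (eval_at f)] -> prime_ideal [set: {poly A}] J.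
Proof.
move=> [iP P1 PM] ->; split; [split=> //=| |] => /=.
- by rewrite rmorph0; apply: (ideal0 iP).
- by move=> f g Pf Pg; rewrite rmorphD; apply: (idealD iP).
- by move=> f g _ Pg; rewrite rmorphM; apply: (idealM iP) => //; apply: eval_atO.
- by rewrite rmorph1.
- by move=> f g _ _; rewrite rmorphM; apply: PM; apply: eval_atO.
Qed.

Lemma prime_Q : prime_ideal [set: {poly A}] Q.
Proof.
apply: (prime_eval_at (P := m)) => //.
by apply: units_prime_ideal => //; apply: (local_unitO im).
Qed.

Lemma prime_I : prime_ideal [set: {poly A}] I.
Proof.
apply: (prime_eval_at (P := [set x | x = 0])) => //; split=> //=.
- split=> //= [_ ->|_ _ -> ->|a _ _ ->]; rewrite ?addr0 ?mulr0 //; exact: subring0.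
- by move/eqP; rewrite oner_eq0.
- by move=> x y _ _ /eqP; rewrite mulf_eq0 => /orP[]/eqP; [left|right].
Qed.

Let iQ : ideal [set: {poly A}] Q. Proof. exact: prime_ideal_ideal prime_Q. Qed.
Let iI : ideal [set: {poly A}] I. Proof. exact: prime_ideal_ideal prime_I. Qed.

Let im0 : ideal [set: {poly A}] m0.
Proof.
apply: ideal_poly_ideal; split=> //= [|a b ma mb|a b _ mb]; first by rewrite rmorph0.
  by rewrite rmorphD; apply: (idealD im).
by rewrite /= rmorphM; apply: (idealM im).
Qed.

Lemma m0Q : m0 `<=` Q.
Proof.
move=> f m0f; rewrite /Q /= eval_atE horner_coef.
elim/big_ind: _ => [//||i _]; first exact: (idealD im).
by rewrite mulrC coef_map; apply: (idealM im); [apply: subringX|apply: m0f].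
Qed.

Lemma m0_deriv f : m0 f -> m0 f^`().
Proof.
move=> m0f i; rewrite coef_deriv /= raddfMn -mulr_natl.
by apply: (idealM im); [apply: subring_nat|apply: m0f].
Qed.

(** Otherwise the coefficients of the derivative, and so its value at [eta], would lie in [m]. Thus
    [h], though perhaps not monic, has nonzero residue. *)
Lemma h_not_m0 : ~ m0 h.
Proof. by move=> /m0_deriv/m0Q. Qed.

Lemma minimal_poly (S : {poly A} -> Prop) f0 : S f0 ->
  exists2 P, S P & forall f, S f -> (size P <= size f)%N.
Proof.
move=> Sf0; have ex : exists n, `[< exists2 f, S f & size f = n >].
  by exists (size f0); apply/asboolP; exists f0.
case: (ex_minnP ex) => _ /asboolP[P SP <-] Pmin; exists P => // f Sf.
by apply: Pmin; apply/asboolP; exists f.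
Qed.

(* P lifts the minimal polynomial of the residue of eta. *)
Lemma residue_minimal_poly : exists P, [/\ P \is monic, Q P, ~ m0 P
  & forall f, Q f -> (size f < size P)%N -> m0 f].
Proof.
have [|P0 [QP0 m0P0] P0min] := @minimal_poly (fun f => Q f /\ ~ m0 f) h.
  by split; [rewrite /Q /= h0|apply: h_not_m0].
have small f : Q f -> (size f < size P0)%N -> m0 f.
  by move=> Qf; rewrite ltnNge => szf; apply: contrapT => m0f; case/negP: szf; apply: P0min.
(* If the leading coefficient were in [m], dropping the leading term would leave a smaller member of
   [Q], which lies in [m0] by minimality; then [P0] would too. *)
have [b lb] : exists b, lead_coef P0 * b = 1.
  apply: unitA => mlc; apply: (m0P0).
  pose n := (size P0).-1; pose f := P0 - (lead_coef P0)%:P * 'X^n.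
  have P0n0 : P0 != 0 by apply/eqP => P00; apply: m0P0 => i; rewrite P00 coef0 /= rmorph0.
  have szn : size P0 = n.+1 by rewrite prednK // lt0n size_poly_eq0.
  have m0l : m0 ((lead_coef P0)%:P * 'X^n).
    move=> i; rewrite coefCM /= rmorphM mulrC; apply: (idealM im) => //; exact: iotaO.
  have : m0 f.
    apply: small; first by apply: idealB => //; apply: m0Q.
    rewrite szn ltnS; apply: size_leq_coef0.
      rewrite (leq_trans (size_polyD _ _)) // geq_max szn leqnn size_polyN mul_polyC.
      by rewrite (leq_trans (size_scale_leq _ _)) // size_polyXn.
    by rewrite coefB coefCM coefXn eqxx mulr1 subrr.
  move=> m0f i; rewrite -(subrK ((lead_coef P0)%:P * 'X^n) P0) coefD /= rmorphD.
  by apply: (idealD im); [apply: m0f|apply: m0l].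
have szb : size (b%:P * P0) = size P0.
  apply/eqP; rewrite eqn_leq mul_polyC size_scale_leq /=.
  have {1}-> : P0 = (lead_coef P0) *: (b *: P0) by rewrite scalerA lb scale1r.
  exact: size_scale_leq.
exists (b%:P * P0); split.
- by rewrite monicE lead_coefE szb coefCM -lead_coefE mulrC lb.
- exact: idealMl.
- move=> m0bP; apply: m0P0 => i.
  have -> : P0`_i = lead_coef P0 * (b%:P * P0)`_i by rewrite coefCM mulrA lb mul1r.
  by rewrite /= rmorphM; apply: (idealM im); [apply: iotaO|apply: m0bP].
- by rewrite szb.
Qed.

(** [W] is the cofactor of [P] in [h] modulo [m0]. Differentiating [h = W * P + r] shows that with
    [W] in [Q] the derivative of [h] would be in [Q]. *)
Lemma unramified : exists2 W, ~ Q W &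
  forall f, Q f -> exists S r, m0 r /\ W * f = S * h + r.
Proof.
have [P [monP QP _ Pmin]] := residue_minimal_poly.
have div f : Q f -> exists S r, m0 r /\ f = S * P + r.
  move=> Qf; exists (Pdiv.Ring.rdivp f P), (Pdiv.Ring.rmodp f P).
  have E := Pdiv.ComRing.rdivp_eq P f; rewrite (monicP monP) expr1n scale1r in E.
  split=> //; apply: Pmin; last by rewrite Pdiv.Ring.ltn_rmodp monic_neq0.
  apply: (ideal_addKl iQ (x := Pdiv.Ring.rdivp f P * P)); first by rewrite -E.
  exact: idealMl.
have [W [r [m0r hE]]] : exists S r, m0 r /\ h = S * P + r.
  by apply: div; rewrite /Q /= h0.
exists W => [QW|f /div[S [r' [m0r' ->]]]]; last first.
  exists S, (W * r' - S * r); split; last by rewrite hE; ring.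
  by apply: (idealB im0); apply: (idealMl _ im0).
suff : Q h^`() by [].
have Qr' : Q r^`() by apply/m0Q/m0_deriv.
rewrite hE derivD derivM; apply: (idealD iQ) => //.
by apply: (idealD iQ); [apply: idealMl|apply: idealMr].
Qed.

(* Over the fraction field of A, h is a multiple of the minimal polynomial of
   eta, by a factor that does not vanish at eta since eta is a simple root. *)
Lemma kernel_torsion f : I f -> exists U W, ~ I U /\ U * f = W * h.
Proof.
move=> If; have nIh' : ~ I h^`() by move=> Ih'; apply: h'm; rewrite Ih'.
(* [g] is the minimal polynomial of [eta] over the fraction field, up to denominators; hence
   pseudo-division by [g] is exact on [I]. *)
have [|g [Ig gn0] gmin] := @minimal_poly (fun f => I f /\ f != 0) h.
  by split=> //; apply/eqP => hh; apply: nIh'; rewrite hh deriv0; apply: (ideal0 iI).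
have div k : I k -> lead_coef g ^+ Pdiv.Ring.rscalp k g *: k = Pdiv.Ring.rdivp k g * g.
  move=> Ik; have E := Pdiv.ComRing.rdivp_eq g k.
  suff r0 : Pdiv.Ring.rmodp k g = 0 by rewrite E r0 addr0.
  apply/eqP; apply: contraT => rn0.
  suff : (size g <= size (Pdiv.Ring.rmodp k g))%N.
    by rewrite leqNgt Pdiv.Ring.ltn_rmodp gn0.
  apply: gmin; split=> //; apply: (ideal_addKl iI (x := Pdiv.Ring.rdivp k g * g)).
    by rewrite -E -mul_polyC; apply: idealMl.
  exact: idealMl.
have lcX n : ~ I (lead_coef g ^+ n)%:P.
  rewrite /I /= eval_atC rmorphXn => /eqP; rewrite expf_eq0 => /andP[_].
  by rewrite -(rmorph0 iota) (inj_eq iota_inj) lead_coef_eq0 (negPf gn0).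
move: (div f If) (div h h0); set k := Pdiv.Ring.rscalp f g; set l := Pdiv.Ring.rscalp h g.
set w1 := Pdiv.Ring.rdivp f g; set w2 := Pdiv.Ring.rdivp h g => Ef Eh.
(* Cross-multiplication of [Ef] and [Eh]. If [w2] vanished at [eta], differentiating [Eh] would make
   [eta] a multiple root of [h]. *)
exists (w2 * (lead_coef g ^+ k)%:P), (w1 * (lead_coef g ^+ l)%:P); split; last first.
  rewrite -mulrA mul_polyC Ef -mulrA mul_polyC Eh; ring.
apply: (primeNM prime_I) => // Iw2.
have : I (lead_coef g ^+ l *: h^`()).
  rewrite -derivZ Eh derivM; apply: (idealD iI); first exact: idealMl.
  exact: idealMr.
by rewrite -mul_polyC => /(primeM prime_I)[/lcX|/nIh'].
Qed.

Variables (d : nat) (x : 'I_d -> A).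
Hypothesis mA_gen : [set a | m (iota a)] = ideal_span [set: A] x.

Let xs : seq {poly A} := codom (fun i => (x i)%:P).

Let m_x i : m (iota (x i)).
Proof.
suff : [set a | m (iota a)] (x i) by [].
by rewrite mA_gen; apply: mem_ideal_span; apply: subring_setT.
Qed.

Let xsQ f : f \in xs -> Q f.
Proof. by move=> /codomP[i ->]; rewrite /Q /= eval_atC. Qed.

Let size_xs : size xs = d.
Proof. by rewrite size_codom card_ord. Qed.

(** By [unramified] a member of [Q] is, up to a factor outside [Q], a multiple of [h] plus a
    polynomial whose coefficients are combinations of the [x i]. *)
Lemma Q_gen : Q `<=` saturation Q (ideal_gen ([set h] `|` [set` xs])).
Proof.
have igen := ideal_ideal_gen ([set h] `|` [set` xs]).
move=> f Qf; have [W nQW /(_ f Qf)[S [r [m0r E]]]] := unramified.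
exists W => //; rewrite E; apply: (idealD igen).
  by apply: (idealMl _ igen); apply: sub_ideal_gen; left.
rewrite -[r]coefK poly_def; apply: ideal_sum => [|i _]; first exact: igen.
rewrite -mul_polyC; apply: (idealMr _ igen).
have : [set a | m (iota a)] r`_i by apply: m0r.
rewrite mA_gen => -[a _ ->]; rewrite rmorph_sum; apply: ideal_sum => [|j _]; first exact: igen.
rewrite rmorphM; apply: (idealMl _ igen); apply: sub_ideal_gen; right => /=.
exact: (codom_f (fun i => (x i)%:P)).
Qed.

(** The upper bound on the dimension. As [h] is in [I], [Q] is minimal over [P] and the [d]
    parameters; a path ending properly below [Q] is first prolonged to [Q]. *)
Lemma path_sub_Q n P R : noetherian [set: A] ->
  prime_ideal [set: {poly A}] P -> I `<=` P -> R `<=` Q ->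
  prime_path n P R -> (n <= d)%N.
Proof.
move=> noethA pP IP RQ PR.
have noethX := hilbert_basis noethA.
have bound k : prime_path k P Q -> (k <= d)%N.
  rewrite -size_xs; apply: height_theorem => // Q' pQ' PQ' xsQ' Q'Q.
  apply: subset_trans Q_gen _; apply: saturation_sub; first exact: prime_saturated.
  apply: ideal_gen_sub; first exact: prime_ideal_ideal.
  by move=> y [->|/xsQ'//]; apply/PQ'/IP.
have [QR|nQR] := pselect (Q `<=` R).
  by apply: bound; suff -> : Q = R by []; apply/seteqP.
by apply/ltnW/bound; apply: prime_path_rcons PR _; [apply: prime_Q|].
Qed.

(** The lower bound on the dimension. *)
Lemma path_I_Q P0 P1 : noetherian [set: A] -> prime_ideal [set: A] P0 ->
  prime_path d P0 P1 -> prime_path d I Q.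
Proof.
move=> noethA pP0 P01; have noethX := hilbert_basis noethA.
have [pP1 pP0X] := (prime_path_prime pP0 P01, prime_poly_ideal pP0).
have P1m a : P1 a -> m (iota a).
  move=> P1a; apply: contrapT => /unitA[b ab]; case: (pP1) => i1 + _; apply.
  by rewrite -ab; apply: idealMr.
(* Strictness supplies the extra step of the path: the lifted residue polynomial is in [Q] but not
   all its coefficients are in [m]. *)
have P1Q : poly_ideal P1 `<` Q.
  split=> [f P1f|QP1]; first by apply: m0Q => i; apply: P1m.
  have [P [_ QP nm0 _]] := residue_minimal_poly; apply: nm0 => i.
  exact/P1m/(QP1 P QP).
have PQ : prime_path d.+1 (poly_ideal P0) Q.
  by apply: prime_path_rcons P1Q; [apply: prime_Q|apply: prime_path_poly].
have [|J [pJ Jh _ JQ]] := prime_path_move noethX (x := h) pP0X PQ.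
  by rewrite /Q /= h0.
(* [regular_prime] applies with [h] as the base set: [d] parameters remain, and the path from [J] to
   [Q] has length [d]. *)
have JI : J `<=` I.
  have /subset_trans : J `<=` saturation Q (ideal_gen [set h]).
    apply: (regular_prime noethX (xs := xs)) => //; rewrite ?size_xs //.
      by move=> _ ->.
    exact: Q_gen.
  apply; apply: saturation_sub; last by apply: ideal_gen_sub => // _ ->.
  by apply: prime_saturated; [apply: prime_I|move=> f; rewrite /Q /= => ->].
suff <- : J = I by [].
apply/seteqP; split=> // f /kernel_torsion[U [W [nIU E]]].
have /(primeM pJ)[/JI//|//] : J (U * f).
by rewrite E; apply: idealMl => //; apply: prime_ideal_ideal.
Qed.

(** The subring A[eta] of [F], localized at its contraction of [m]. *)
Definition etale_ring : set F :=
  [set y | exists f g, ~ m (eval_at g) /\ y = eval_at f / eval_at g].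
Let B := etale_ring.

Let ev_neq0 g : ~ Q g -> eval_at g != 0.
Proof. exact: notin_ideal_neq0 im _. Qed.

Let nQ1 : ~ Q 1. Proof. by rewrite /Q /= rmorph1. Qed.

Lemma etale_eval f : B (eval_at f).
Proof. by exists f, 1; rewrite rmorph1 divr1. Qed.

Lemma subring_etale : subring B.
Proof.
split=> [|y z|y z].
- by apply/asboolP; rewrite -(rmorph1 eval_at); apply: etale_eval.
- move=> /asboolP[f [g [nQg ->]]] /asboolP[f' [g' [nQg' ->]]]; apply/asboolP.
  exists (f * g' - f' * g), (g * g'); split; first exact: (primeNM prime_Q).
  by rewrite -mulNr addf_div ?ev_neq0 // rmorphB !rmorphM mulNr.
- move=> /asboolP[f [g [nQg ->]]] /asboolP[f' [g' [nQg' ->]]]; apply/asboolP.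
  exists (f * f'), (g * g'); split; first exact: (primeNM prime_Q).
  by rewrite !rmorphM mulf_div.
Qed.

Lemma etale_sub : B `<=` O.
Proof.
move=> _ [f [g [nQg ->]]]; apply: subringM => //; first exact: eval_atO.
by apply: unitO => //; apply: eval_atO.
Qed.

Lemma etale_inv y : B y -> ~ m y -> B y^-1.
Proof.
move=> [f [g [nQg ->]]] mfg; exists g, f; rewrite invfM invrK mulrC; split=> // mf.
apply: mfg; rewrite mulrC; apply: (idealM im) => //.
by apply: unitO => //; apply: eval_atO.
Qed.

Lemma etale_local_ring : local_ring B (B `&` m).
Proof.
exact: (dominated_local_ring im m1 subring_etale etale_sub etale_inv).
Qed.

(** An ideal of [B] is generated by the values of generators of its preimage in A[X], since
    denominators are units of [B]. *)
Lemma etale_noetherian : noetherian [set: A] -> noetherian B.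
Proof.
move=> /hilbert_basis noethX J iJ; have sB := subring_etale.
have [|n [g Jg]] := noethX [set f | J (eval_at f)].
  split=> //= [|f g Jf Jg|f g _ Jg]; rewrite ?rmorph0 ?rmorphD ?rmorphM.
  - exact: (ideal0 iJ).
  - exact: (idealD iJ).
  - by apply: (idealM iJ) => //; apply: etale_eval.
have Jgi i : J (eval_at (g i)).
  suff : [set f | J (eval_at f)] (g i) by [].
  by rewrite Jg; apply: mem_ideal_span; apply: subring_setT.
exists n, (fun i => eval_at (g i)); apply/seteqP; split; last exact: ideal_span_sub.
move=> y Jy; have [f [k [nQk yE]]] := ideal_sub iJ Jy.
have : [set f | J (eval_at f)] f.
  rewrite /= (_ : eval_at f = eval_at k * y); last by rewrite yE mulrC divfK ?ev_neq0.
  by apply: (idealM iJ) => //; apply: etale_eval.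
rewrite Jg => -[a _ fE]; rewrite yE mulrC; apply: ideal_spanM => //.
  by exists 1, k; rewrite rmorph1 mul1r.
exists (fun i => eval_at (a i)) => [i|]; first exact: etale_eval.
by rewrite fE rmorph_sum; apply: eq_bigr => i _; rewrite rmorphM.
Qed.

(** Of the generators of [Q] in [Q_gen], [h] vanishes at [eta], so only the parameters of [A]
    survive. *)
Lemma etale_maximal_ideal : B `&` m = ideal_span B (fun i => iota (x i)).
Proof.
have sB := subring_etale.
have [[iBm _ _] _] := etale_local_ring.
apply/seteqP; split; last first.
  apply: ideal_span_sub => // i; split; last exact: m_x.
  by rewrite -eval_atC; apply: etale_eval.
move=> _ [[f [g [nQg ->]]] mfg].
have Qf : Q f.
  rewrite /Q /= -(divfK (ev_neq0 nQg) (eval_at f)) mulrC.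
  by apply: (idealM im) => //; apply: eval_atO.
have [s nQs] := Q_gen Qf.
have /[apply] : ideal_gen ([set h] `|` [set` xs]) `<=`
    [set f | ideal_span B (fun i => iota (x i)) (eval_at f)].
  apply: ideal_gen_sub.
    split=> //= [|f1 f2 I1 I2|f1 f2 _ I2]; rewrite ?rmorph0 ?rmorphD ?rmorphM.
    - exact: ideal_span0.
    - exact: ideal_spanD.
    - by apply: ideal_spanM => //; apply: etale_eval.
  move=> y [->|/codomP[i ->]] /=; first by rewrite h0; apply: ideal_span0.
  by rewrite eval_atC; apply: (mem_ideal_span sB).
rewrite /= rmorphM => Isf.
have -> : eval_at f / eval_at g = (1 / eval_at (s * g)) * (eval_at s * eval_at f).
  by rewrite rmorphM; field; rewrite !ev_neq0.
apply: ideal_spanM => //; exists 1, (s * g); rewrite rmorph1; split=> //.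
exact: (primeNM prime_Q).
Qed.

Definition etale_ext (J : set {poly A}) : set F :=
  [set y | exists f g, [/\ J f, ~ m (eval_at g) & y = eval_at f / eval_at g]].

(** Numerators may be tested in any representation: cross-multiplied, two of them differ by an
    element of [I], and denominators are outside [J]. *)
Lemma etale_extE J f g : prime_ideal [set: {poly A}] J -> I `<=` J -> J `<=` Q ->
  ~ Q g -> etale_ext J (eval_at f / eval_at g) -> J f.
Proof.
move=> pJ IJ JQ nQg [f' [g' [Jf' nQg' /eqP]]].
rewrite eqr_div ?ev_neq0 // -!rmorphM -subr_eq0 -rmorphB => /eqP/IJ Jfg.
have iJ := prime_ideal_ideal pJ.
have /(primeM pJ)[//|/JQ//] : J (f * g').
by rewrite -(subrK (f' * g) (f * g')); apply: (idealD iJ) => //; apply: idealMr.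
Qed.

Lemma prime_etale_ext J : prime_ideal [set: {poly A}] J -> I `<=` J -> J `<=` Q ->
  prime_ideal B (etale_ext J).
Proof.
move=> pJ IJ JQ; have iJ := prime_ideal_ideal pJ; split; [split| |].
- by move=> _ [f [g [_ nQg ->]]]; exists f, g.
- by exists 0, 1; rewrite rmorph0 mul0r; split=> //; apply: (ideal0 iJ).
- move=> _ _ [f [g [Jf nQg ->]]] [f' [g' [Jf' nQg' ->]]].
  exists (f * g' + f' * g), (g * g'); split.
  + by apply: (idealD iJ); apply: idealMr.
  + exact: (primeNM prime_Q).
  + by rewrite addf_div ?ev_neq0 // rmorphD !rmorphM.
- move=> _ _ [f [g [nQg ->]]] [f' [g' [Jf' nQg' ->]]].
  exists (f * f'), (g * g'); split; first exact: idealMl.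
  + exact: (primeNM prime_Q).
  + by rewrite mulf_div !rmorphM.
- have -> : 1 = eval_at 1 / eval_at 1 by rewrite rmorph1 divr1.
  by move=> /(etale_extE pJ IJ JQ nQ1)/JQ.
- move=> _ _ [f [g [nQg ->]]] [f' [g' [nQg' ->]]].
  rewrite mulf_div -!rmorphM => /(etale_extE pJ IJ JQ (primeNM prime_Q nQg nQg')).
  by move=> /(primeM pJ)[Jf|Jf]; [left; exists f, g|right; exists f', g'].
Qed.

Lemma prime_etale_contraction P : prime_ideal B P ->
  [/\ prime_ideal [set: {poly A}] [set f | P (eval_at f)],
      I `<=` [set f | P (eval_at f)] & [set f | P (eval_at f)] `<=` Q].
Proof.
move=> [iP P1 PM]; split; [split; [split=> //=| |] => /=| |].
- by rewrite rmorph0; apply: (ideal0 iP).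
- by move=> f g Pf Pg; rewrite rmorphD; apply: (idealD iP).
- by move=> f g _ Pg; rewrite rmorphM; apply: (idealM iP) => //; apply: etale_eval.
- by rewrite rmorph1.
- by move=> f g _ _; rewrite rmorphM; apply: PM; apply: etale_eval.
- by move=> f /= ->; apply: (ideal0 iP).
- move=> f /= Pf; apply: contrapT => nQf; apply: P1.
  rewrite -(mulVf (ev_neq0 nQf)); apply: (idealM iP) => //.
  by apply: etale_inv => //; apply: etale_eval.
Qed.

(** Extension of primes lying between [I] and [Q], and contraction of primes of [B], preserve strict
    inclusions, so the two bounds on paths in A[X] carry over. *)
Lemma etale_krull_dim : noetherian [set: A] ->
  (exists P : 'I_d.+1 -> set A, prime_chain [set: A] P) -> krull_dim B d.
Proof.
move=> noethA [P0 chP0]; split.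
  have := path_I_Q noethA (chP0.1 ord0) (prime_chain_path chP0).
  move=> /(prime_path_chain prime_I)[f [chf f0 fd]].
  have fb i : I `<=` f i /\ f i `<=` Q.
    by have := prime_chain_sub chf i; rewrite f0 fd.
  have [pf lf] := chf.
  exists (fun i => etale_ext (f i)); split=> [i|i j ij].
    by apply: prime_etale_ext => //; case: (fb i).
  have [fij nfij] := lf _ _ ij; split=> [_ [a [g [fa nQg ->]]]|sub].
    by exists a, g; split=> //; apply: fij.
  apply: nfij => a fja; have [If fQ] := fb i.
  apply: (etale_extE (pf i) If fQ nQ1); apply: sub; exists a, 1; split=> //.
move=> n P [pP lP].
pose C i := [set f | P i (eval_at f)].
have CP i := prime_etale_contraction (pP i).
have chC : prime_chain [set: {poly A}] C.
  split=> [i|i j ij]; first by case: (CP i).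
  have [Pij nPij] := lP _ _ ij; split=> [f /Pij//|sub].
  have [[iPj _ _] [iPi _ _]] := (pP j, pP i).
  apply: nPij => y Pjy; have [f [g [nQg yE]]] := ideal_sub iPj Pjy.
  have Cf : C j f.
    rewrite /C /= (_ : eval_at f = eval_at g * y); last by rewrite yE mulrC divfK ?ev_neq0.
    by apply: (idealM iPj) => //; apply: etale_eval.
  rewrite yE mulrC; apply: (idealM iPi); last exact: sub.
  by apply: etale_inv => //; apply: etale_eval.
have [pC0 IC0 _] := CP ord0; have [_ _ CQ] := CP ord_max.
exact: path_sub_Q noethA pC0 IC0 CQ (prime_chain_path chC).
Qed.

Lemma etale_regular : noetherian [set: A] ->
  (exists P : 'I_d.+1 -> set A, prime_chain [set: A] P) -> regular_local_ring B.
Proof.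
move=> noethA chA; split; [exact: subring_etale|exact: etale_noetherian|].
exists (B `&` m); split; first exact: etale_local_ring.
exists d; first exact: etale_krull_dim.
by exists (fun i => iota (x i)); apply: etale_maximal_ideal.
Qed.

End Etale.

(** * Regularity of the centre *)

Section SubringType.
Variables (L : comNzRingType) (A : set L) (sA : subring A).

(** The closure proof is an argument so that the closedness instance can be attached to the
    predicate. *)
Definition subring_pred of subring A : {pred L} := [pred x | x \in A].

HB.instance Definition _ := GRing.isSubringClosed.Build L (subring_pred sA) sA.

Record subring_type := SubringType { subring_val : L; _ : subring_val \in subring_pred sA }.

HB.instance Definition _ := [isSub for subring_val].
HB.instance Definition _ := [Choice of subring_type by <:].
HB.instance Definition _ := [SubChoice_isSubComNzRing of subring_type by <:].
HB.instance Definition _ := GRing.RMorphism.copy subring_val (val : subring_type -> L).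

Lemma subring_valP (a : subring_type) : A (subring_val a).
Proof. by apply/asboolP; case: a. Qed.

Lemma subring_val_lift x : A x -> exists a : subring_type, subring_val a = x.
Proof.
move=> Ax; have Ax' : x \in subring_pred sA by apply/asboolP.
by exists (SubringType Ax').
Qed.

Lemma subring_type_noetherian : noetherian A -> noetherian [set: subring_type].
Proof.
move=> noethA J iJ.
have [|n [g gE]] := noethA (subring_val @` J).
  split.
  - by move=> _ [a _ <-]; apply: subring_valP.
  - by exists 0; [apply: (ideal0 iJ)|].
  - by move=> _ _ [a Ja <-] [b Jb <-]; exists (a + b); [apply: (idealD iJ)|].
  - move=> y _ /subring_val_lift[a <-] [b Jb <-]; exists (a * b); last by [].
    exact: (idealM iJ).
have /choice[f fP] : forall i, exists a, J a /\ subring_val a = g i.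
  move=> i; suff : (subring_val @` J) (g i) by case=> a; exists a.
  by rewrite gE; apply: mem_ideal_span.
exists n, f; apply/seteqP; split; last by apply: ideal_span_sub => // i; case: (fP i).
move=> a Ja; have : (subring_val @` J) (subring_val a) by exists a.
rewrite gE => -[c Ac aE].
have /choice[c' c'E] : forall i, exists b : subring_type, subring_val b = c i.
  by move=> i; apply: subring_val_lift.
exists c' => //; apply: val_inj; rewrite /= aE rmorph_sum /=.
by apply: eq_bigr => i _; rewrite c'E; case: (fP i) => _ ->.
Qed.

Lemma subring_type_prime P : prime_ideal A P ->
  prime_ideal [set: subring_type] [set a | P (subring_val a)].
Proof.
move=> [iP P1 PM]; split; [split=> //=| |] => /=.
- exact: (ideal0 iP).
- by move=> a b Pa Pb; apply: (idealD iP).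
- by move=> a b _ Pb; apply: (idealM iP) => //; apply: subring_valP.
- exact: P1.
- by move=> a b _ _; apply: PM; apply: subring_valP.
Qed.

Lemma subring_type_chain n (P : 'I_n.+1 -> set L) : prime_chain A P ->
  prime_chain [set: subring_type] (fun i => [set a | P i (subring_val a)]).
Proof.
move=> [pP lP]; split=> [i|i j ij]; first exact: subring_type_prime.
have [Pij nPij] := lP _ _ ij; split=> [a /Pij//|sub]; apply: nPij => y Pjy.
have [iPj _ _] := pP j; have [a ay] := subring_val_lift (ideal_sub iPj Pjy).
by rewrite -ay; apply: sub; rewrite /= ay.
Qed.

Lemma subring_type_poly (p : {poly L}) : (forall i, A p`_i) ->
  exists q : {poly subring_type}, map_poly subring_val q = p.
Proof.
move=> Ap; have /choice[c cE] : forall i, exists a : subring_type, subring_val a = p`_i.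
  by move=> i; apply: subring_val_lift.
exists (\poly_(i < size p) c i); apply/polyP => i.
rewrite coef_map coef_poly; case: ltnP => [_|szp]; first exact: cE.
by rewrite [RHS]nth_default.
Qed.

End SubringType.

Lemma subring_ring_adjoin (L : comNzRingType) (A S : set L) : subring (ring_adjoin A S).
Proof.
split=> [|x y /asboolP Ax /asboolP Ay|x y /asboolP Ax /asboolP Ay]; apply/asboolP.
- by move=> B [sB _]; apply: subring1.
- by move=> B BP; have [sB _] := BP; apply: subringB => //; [apply: Ax|apply: Ay].
- by move=> B BP; have [sB _] := BP; apply: subringM => //; [apply: Ax|apply: Ay].
Qed.

Lemma ring_adjoin_base (L : comNzRingType) (A S : set L) : A `<=` ring_adjoin A S.
Proof. by move=> x Ax B [_]; apply; left. Qed.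

Lemma ring_adjoin_gen (L : comNzRingType) (A S : set L) : S `<=` ring_adjoin A S.
Proof. by move=> x Sx B [_]; apply; right. Qed.

Lemma ring_adjoin_min (L : comNzRingType) (A S B : set L) :
  subring B -> A `<=` B -> S `<=` B -> ring_adjoin A S `<=` B.
Proof. by move=> sB AB SB x; apply; split=> // y [/AB|/SB]. Qed.

Lemma ring_adjoinU (L : comNzRingType) (A S S' : set L) :
  ring_adjoin (ring_adjoin A S) S' = ring_adjoin A (S `|` S').
Proof.
apply/seteqP; split; (apply: ring_adjoin_min; first exact: subring_ring_adjoin).
- apply: ring_adjoin_min; first exact: subring_ring_adjoin.
    exact: ring_adjoin_base.
  by move=> x Sx; apply: ring_adjoin_gen; left.
- by move=> x Sx; apply: ring_adjoin_gen; right.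
- by move=> x Ax; do 2!apply: ring_adjoin_base.
- move=> x [Sx|Sx]; last exact: ring_adjoin_gen.
  by apply: ring_adjoin_base; apply: ring_adjoin_gen.
Qed.

Section Centered.
Variables (F : fieldType) (O m : set F).
Hypotheses (sO : subring O) (im : ideal O m) (m1 : ~ m 1).
Hypothesis unitO : forall x, O x -> ~ m x -> O x^-1.

Let m_neq0 x : ~ m x -> x != 0.
Proof. exact: notin_ideal_neq0 im _. Qed.

Let primem : prime_ideal O m.
Proof. by apply: units_prime_ideal => //; apply: (local_unitO im). Qed.

Let primeNm x y : O x -> O y -> ~ m x -> ~ m y -> ~ m (x * y).
Proof. by move=> Ox Oy mx my; case: primem => _ _ PM /(PM _ _ Ox Oy)[]. Qed.

Section CenterLocalization.
Variable R : set F.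
Hypotheses (sR : subring R) (RO : R `<=` O).

Local Notation loc := (localization R (R `&` m)).

Lemma locE y : loc y <-> exists a b, [/\ R a, R b, ~ m b & y = a / b].
Proof.
split=> [[a [b [Ra Rb nmb ->]]]|[a [b [Ra Rb nmb ->]]]]; exists a, b; split=> //.
  by move=> mb; apply: nmb.
by case.
Qed.

Lemma loc_base : R `<=` loc.
Proof.
move=> x Rx; apply/locE; exists x, 1; split=> //; first exact: subring1.
by rewrite divr1.
Qed.

Lemma subring_loc : subring loc.
Proof.
split=> [|y z|y z].
- by apply/asboolP; apply: loc_base; apply: subring1.
- move=> /asboolP/locE[a [b [Ra Rb mb ->]]] /asboolP/locE[a' [b' [Ra' Rb' mb' ->]]].
  apply/asboolP/locE; exists (a * b' - a' * b), (b * b'); split.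
  + by apply: subringB => //; apply: subringM.
  + exact: subringM.
  + by apply: primeNm => //; apply: RO.
  + by rewrite -mulNr addf_div ?m_neq0 // mulNr.
- move=> /asboolP/locE[a [b [Ra Rb mb ->]]] /asboolP/locE[a' [b' [Ra' Rb' mb' ->]]].
  apply/asboolP/locE; exists (a * a'), (b * b'); split; try exact: subringM.
  + by apply: primeNm => //; apply: RO.
  + by rewrite mulf_div.
Qed.

Lemma loc_sub : loc `<=` O.
Proof.
move=> _ /locE[a [b [Ra Rb mb ->]]]; apply: subringM => //; first exact: RO.
by apply: unitO => //; apply: RO.
Qed.

Lemma loc_inv y : loc y -> ~ m y -> loc y^-1.
Proof.
move=> /locE[a [b [Ra Rb mb ->]]] mab; apply/locE; exists b, a.
rewrite invfM invrK mulrC; split=> // ma; apply: mab.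
rewrite mulrC; apply: (idealM im) => //; apply: unitO => //; exact: RO.
Qed.

Lemma loc_min S : subring S -> R `<=` S -> (forall y, R y -> ~ m y -> S y^-1) ->
  loc `<=` S.
Proof.
move=> sS RS Sinv _ /locE[a [b [Ra Rb mb ->]]]; apply: subringM => //.
  exact: RS.
exact: Sinv.
Qed.

Lemma subring_horner S (p : {poly F}) y : subring S -> (forall i, S p`_i) -> S y -> S p.[y].
Proof.
move=> sS Sp Sy; rewrite horner_coef; apply: subring_sum => // i _.
by apply: subringM => //; apply: subringX.
Qed.

End CenterLocalization.

Local Notation loc R := (localization R (R `&` m)).

(** [etale_regular] is applied to the localization of [R], made into a type; the resulting ring is
    then identified with the localization of R[eta]. *)
Lemma regular_adjoin1 R eta (h : {poly F}) : subring R -> R `<=` O ->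
  regular_local_ring (loc R) -> O eta ->
  (forall i, loc R h`_i) -> h.[eta] = 0 -> ~ m h^`().[eta] ->
  regular_local_ring (loc (ring_adjoin R [set eta])).
Proof.
move=> sR RO [sl noethl [M [locM [d [chd _] [g gE]]]]] Oeta hl h0 h'm.
have [h1 h1E] := subring_type_poly sl hl.
pose A : comNzRingType := subring_type sl.
pose iota : {rmorphism A -> F} := @subring_val F (loc R) sl.
have iotaO (a : A) : O (iota a) by apply: (loc_sub RO); apply: subring_valP.
have unitA (a : A) : ~ m (iota a) -> exists b, a * b = 1.
  move=> ma; have [b bE] := subring_val_lift sl (loc_inv RO (subring_valP a) ma).
  exists b; apply: val_inj; rewrite /= bE mulfV //; exact: m_neq0.
(* The maximal ideal given by regularity must be the contraction of [m], by uniqueness. *)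
have ME : M = loc R `&` m.
  have [_ Muniq] := locM.
  have [maxlm _] : local_ring (loc R) (loc R `&` m).
    exact: (dominated_local_ring im m1 sl (loc_sub RO) (loc_inv RO)).
  by rewrite (Muniq _ maxlm).
have /choice[x xE] : forall i, exists a : A, iota a = g i.
  move=> i; apply: subring_val_lift; suff [] : (loc R `&` m) (g i) by [].
  by rewrite -ME gE; apply: mem_ideal_span.
have mA : [set a : A | m (iota a)] = ideal_span [set: A] x.
  apply/seteqP; split=> a /=.
    move=> ma; have : M (iota a) by rewrite ME; split=> //; apply: subring_valP.
    rewrite gE => -[c lc aE].
    have /choice[c' c'E] : forall i, exists b : A, iota b = c i.
      by move=> i; apply: subring_val_lift.
    exists c' => //; apply: val_inj; rewrite -[val a]/(iota a) aE rmorph_sum.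
    by apply: eq_bigr => i _; rewrite rmorphM -c'E -xE.
  move=> [c _ ->]; rewrite rmorph_sum; elim/big_ind: _ => [||i _].
  - exact: (ideal0 im).
  - exact: (idealD im).
  - rewrite rmorphM xE; apply: (idealM im) => //.
    by suff [] : (loc R `&` m) (g i) by []; rewrite -ME gE; apply: mem_ideal_span.
have chA : exists P : 'I_d.+1 -> set A, prime_chain [set: A] P.
  have [P chP] := chd; exists (fun i => [set a | P i (subring_val a)]).
  exact: subring_type_chain.
have evE f : eval_at iota eta f = (map_poly iota f).[eta] by [].
have iota_inj : injective iota by exact: val_inj.
have hev : eval_at iota eta h1 = 0 by rewrite evE h1E.
have h'ev : ~ m (eval_at iota eta h1^`()) by rewrite evE -deriv_map h1E.
have := etale_regular iota_inj sO im m1 unitO iotaO unitA Oeta hev h'ev mA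
  (subring_type_noetherian noethl) chA.
set R' := ring_adjoin R [set eta].
have sR' : subring R' by apply: subring_ring_adjoin.
have R'O : R' `<=` O by apply: ring_adjoin_min => // _ ->.
have R'eta : R' eta by apply: ring_adjoin_gen.
have RR' : R `<=` R' by apply: ring_adjoin_base.
(* Each of the two rings contains the generators of the other and inverts its own elements outside
   [m]. *)
suff -> : etale_ring iota m eta = loc R' by [].
have sB := subring_etale sO im m1 unitO iotaO Oeta.
have [sl' l'R'] := (subring_loc sR' R'O, @loc_base R' sR').
have evl f : loc R' (eval_at iota eta f).
  rewrite evE; apply: subring_horner => // [i|]; last exact: l'R'.
  rewrite coef_map; apply: (@loc_min R (loc R')) (subring_valP _) => //.
    by move=> y /RR'/l'R'.
  by move=> y Ry my; apply: (loc_inv R'O) my; exact: (l'R' _ (RR' _ Ry)).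
apply/seteqP; split=> [_ [f [k [mk ->]]]|].
  by apply: (subringM sl') => //; apply: (loc_inv R'O).
have R'B : R' `<=` etale_ring iota m eta.
  apply: ring_adjoin_min => // [y Ry|_ ->].
    have [a <-] := subring_val_lift sl (loc_base sR Ry).
    by have := etale_eval iota m1 eta a%:P; rewrite eval_atC.
  by have := etale_eval iota m1 eta 'X; rewrite eval_atX.
apply: loc_min => // y R'y my.
by apply: (etale_inv sO im unitO iotaO Oeta) => //; apply: R'B.
Qed.

(** Induction on the list: the coefficients for the remaining elements stay in the local ring, which
    only grows. *)
Lemma regular_adjoin R (etas : seq F) : subring R -> R `<=` O ->
  regular_local_ring (loc R) ->
  (forall eta, eta \in etas -> O eta /\ exists h : {poly F},
    [/\ forall i, loc R h`_i, h.[eta] = 0 & ~ m h^`().[eta]]) ->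
  regular_local_ring (loc (ring_adjoin R [set` etas])).
Proof.
elim: etas R => [|eta etas IH] R sR RO regR etasP.
  suff -> : ring_adjoin R [set` [::]] = R by [].
  apply/seteqP; split; first by apply: ring_adjoin_min.
  exact: ring_adjoin_base.
have [Oeta [h [hR h0 h'm]]] := etasP eta (mem_head _ _).
pose R1 := ring_adjoin R [set eta].
have sR1 : subring R1 by apply: subring_ring_adjoin.
have R1O : R1 `<=` O by apply: ring_adjoin_min => // _ ->.
have RR1 : R `<=` R1 by apply: ring_adjoin_base.
have -> : ring_adjoin R [set` eta :: etas] = ring_adjoin R1 [set` etas].
  rewrite ring_adjoinU; congr ring_adjoin; apply/seteqP; split=> y /=; rewrite inE.
    by case/orP=> [/eqP|]; [left|right].
  by case=> [->|->]; rewrite ?eqxx ?orbT.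
apply: IH => // [|eta' eta's]; first exact: (regular_adjoin1 sR RO regR Oeta hR h0 h'm).
have [|Oeta' [h1 [h1R h10 h1'm]]] := etasP eta'; first by rewrite inE eta's orbT.
split=> //; exists h1; split=> // i; apply: (@loc_min R (loc R1)) (h1R i).
- exact: subring_loc.
- by move=> y /RR1/(loc_base sR1).
- by move=> y Ry my; apply: (loc_inv R1O) my; apply: (loc_base sR1); apply: RR1.
Qed.

End Centered.

(** A ring expression over [S] uses only finitely many coefficients [c] from [A]; the conclusion
    lets [A] be replaced by any subring containing these. *)
Lemma ring_adjoin_finite (L : comNzRingType) (A S : set L) z : ring_adjoin A S z ->
  exists2 c : seq L, [set` c] `<=` A & forall B, subring B -> [set` c] `<=` B -> S `<=` B -> B z.
Proof.
pose C := [set z | exists2 c : seq L, [set` c] `<=` A &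
  forall B, subring B -> [set` c] `<=` B -> S `<=` B -> B z].
move: z; suff : ring_adjoin A S `<=` C by [].
have cat_sub (c c' : seq L) B : [set` c ++ c'] `<=` B <-> [set` c] `<=` B /\ [set` c'] `<=` B.
  split=> [cB|[cB c'B] y /=]; last by rewrite mem_cat => /orP[/cB|/c'B].
  by split=> y /= yc; apply: cB; rewrite /= mem_cat yc ?orbT.
apply: ring_adjoin_min => [|a Aa|s Ss].
- split=> [|x y|x y].
  + by apply/asboolP; exists [::] => // B sB _ _; apply: subring1.
  + move=> /asboolP[c cA cP] /asboolP[c' c'A c'P]; apply/asboolP; exists (c ++ c').
      by apply/cat_sub.
    by move=> B sB /cat_sub[cB c'B] SB; apply: subringB => //; [apply: cP|apply: c'P].
  + move=> /asboolP[c cA cP] /asboolP[c' c'A c'P]; apply/asboolP; exists (c ++ c').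
      by apply/cat_sub.
    by move=> B sB /cat_sub[cB c'B] SB; apply: subringM => //; [apply: cP|apply: c'P].
- exists [:: a] => [y /=|B _ aB _]; first by rewrite inE => /eqP->.
  by apply: aB; rewrite /= inE.
- by exists [::] => // B _ _; apply.
Qed.

(** * The valuation ring and its maximal ideal *)

Section Valuation.
Variables (F : fieldType) (G : porderZmodType) (v : F -> G).
Hypothesis vv : krull_valuation v.

Local Notation O := (val_ring v [set: F]).
Local Notation m := (val_ideal v [set: F]).

Let tot (x y : G) : x <= y \/ y <= x.
Proof. by case: (value_group vv) => /(_ x y)/orP. Qed.

Let lerD2 (x y z : G) : x <= y -> z + x <= z + y.
Proof. by case: (value_group vv) => _; apply. Qed.

(** Ordered groups have no 2-torsion; this gives [v (-1) = 0]. *)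
Lemma group_double0 (a : G) : a + a = 0 -> a = 0.
Proof.
move=> aa0; apply/eqP; rewrite eq_le; case: (tot 0 a) => a0.
  by rewrite a0 andbT -[X in _ <= X]aa0 -[X in X <= _]addr0 lerD2.
by rewrite a0 /= -[X in X <= _]aa0 -[X in _ <= X]addr0 lerD2.
Qed.

Lemma valuation1 : v 1 = 0.
Proof.
by apply: (addrI (v 1)); rewrite -(valuationM vv) ?oner_neq0 // mulr1 addr0.
Qed.

Lemma valuationN x : x != 0 -> v (- x) = v x.
Proof.
have N1 : -1 != 0 :> F by rewrite oppr_eq0 oner_neq0.
have vN1 : v (-1) = 0.
  by apply: group_double0; rewrite -(valuationM vv) // mulN1r opprK valuation1.
by move=> x0; rewrite -mulN1r (valuationM vv) // vN1 add0r.
Qed.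

Lemma valuationV x : x != 0 -> v x^-1 = - v x.
Proof.
move=> x0; apply: (addrI (v x)); rewrite subrr -(valuationM vv) ?invr_neq0 //.
by rewrite divff // valuation1.
Qed.

Lemma valuation_ge0_or_V x : x != 0 -> 0 <= v x \/ 0 <= v x^-1.
Proof.
move=> x0; case: (tot 0 (v x)) => vx; [by left|right].
by rewrite valuationV // -[X in X <= _](addNr (v x)) -[X in _ <= X]addr0 lerD2.
Qed.

Lemma valuationD_ge0 x y : O x -> O y -> O (x + y).
Proof.
move=> [_ vx] [_ vy]; split=> // xy0.
have [x0|x0] := eqVneq x 0; first by move: xy0; rewrite x0 add0r; apply: vy.
have [y0|y0] := eqVneq y 0; first by move: xy0; rewrite y0 addr0; apply: vx.
apply: le_trans (valuationD vv x0 y0 xy0); rewrite /Order.min.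
by case: ifP => _; [apply: vx|apply: vy].
Qed.

Lemma subring_val_ring : subring O.
Proof.
split=> [|x y|x y].
- by apply/asboolP; split=> // _; rewrite valuation1.
- move=> /asboolP Ox /asboolP[_ vy]; apply/asboolP/valuationD_ge0 => //.
  by split=> // y0; rewrite oppr_eq0 in y0; rewrite valuationN //; apply: vy.
- move=> /asboolP[_ vx] /asboolP[_ vy]; apply/asboolP; split=> //.
  rewrite mulf_eq0 negb_or => /andP[x0 y0]; rewrite (valuationM vv) //.
  by apply: le_trans (vx x0) _; rewrite -[X in X <= _]addr0 lerD2 // vy.
Qed.

Lemma val_ideal1 : ~ m 1.
Proof. by move=> [_ /(_ (oner_neq0 _))]; rewrite valuation1 ltxx. Qed.

Lemma ideal_val_ideal : ideal O m.
Proof.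
split=> [x [_ vx]||x y [_ vx] [_ vy]|a x [_ va] [_ vx]]; split=> //.
- by move=> x0; apply/ltW/vx.
- by rewrite eqxx.
- move=> xy0.
  have [x0|x0] := eqVneq x 0; first by move: xy0; rewrite x0 add0r; apply: vy.
  have [y0|y0] := eqVneq y 0; first by move: xy0; rewrite y0 addr0; apply: vx.
  apply: lt_le_trans (valuationD vv x0 y0 xy0); rewrite /Order.min.
  by case: ifP => _; [apply: vx|apply: vy].
- rewrite mulf_eq0 negb_or => /andP[a0 x0]; rewrite (valuationM vv) // addrC.
  by apply: lt_le_trans (vx x0) _; rewrite -[X in X <= _]addr0 lerD2 // va.
Qed.

Lemma val_ring_unit x : O x -> ~ m x -> O x^-1.
Proof.
move=> [_ vx] mx; split=> //; rewrite invr_eq0 => x0.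
rewrite valuationV // -[X in X <= _](addNr (v x)) -[X in _ <= X]addr0 lerD2 //.
case: (tot (v x) 0) => // vx0; apply: contrapT => nvx; apply: mx; split=> // _.
rewrite lt_neqAle vx0 andbT; apply/eqP => v0; apply: nvx.
by rewrite -v0.
Qed.

End Valuation.

(** * The affine model of the whole function field *)

Lemma subfield_quotient_field (F : fieldType) (R : set F) : subring R ->
  subfield (quotient_field R).
Proof.
move=> sR; split=> [|x y|x y].
- by apply/asboolP; exists 1, 1; split; rewrite ?divr1 ?oner_neq0 //; apply: subring1.
- move=> /asboolP[a [b [Ra Rb b0 ->]]] /asboolP[a' [b' [Ra' Rb' b'0 ->]]].
  apply/asboolP; exists (a * b' - a' * b), (b * b'); split.
  + by apply: subringB => //; apply: subringM.
  + exact: subringM.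
  + exact: mulf_neq0.
  + by rewrite -mulNr addf_div // mulNr.
- move=> /asboolP[a [b [Ra Rb b0 ->]]] /asboolP[a' [b' [Ra' Rb' b'0 ->]]].
  (* Division by zero is zero by convention, represented as 0 / 1. *)
  apply/asboolP; have [->|a'0] := eqVneq a' 0.
    exists 0, 1; rewrite !(mul0r, invr0, mulr0) oner_neq0; split=> //.
      exact: subring0.
    exact: subring1.
  exists (a * b'), (b * a'); split; try exact: subringM.
    exact: mulf_neq0.
  by rewrite invf_div mulf_div.
Qed.

Theorem theorem1p8 (F : fieldType) (K : set F) (G : porderZmodType) (v : F -> G)
  (K_subfield : subfield K)
  (F_function_field : finitely_generated_field K [set: F])
  (v_valuation : krull_valuation v)
  (v_trivial : trivial_on v K)
  (hyp : forall Z : seq F, [set` Z] `<=` val_ring v [set: F] ->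
    exists (T : set F) (eta : seq F),
      [/\ transcendence_basis K T,
          forall b, b \in eta ->
            henselian_over (val_ring v (field_adjoin K T)) (val_ring v [set: F]) b,
          admits_local_uniformization v K (field_adjoin K T)
        & [set` Z] `<=` ring_adjoin (val_ring v (field_adjoin K T)) [set` eta]]) :
  admits_local_uniformization v K [set: F].
Proof.
move=> Z ZO; have vv := v_valuation.
have [sO im] := (subring_val_ring vv, ideal_val_ideal vv).
have [m1 unitO] := (val_ideal1 vv, val_ring_unit vv).
set O := val_ring v [set: F] in sO im unitO ZO; set m := val_ideal v [set: F] in im m1 unitO.
have [s Fs] := F_function_field.
(* Each field generator or its inverse lies in [O]. Including these in the finite set ensures that
   the final model has quotient field [F]. *)
pose s' := [seq (if `[< O x >] then x else x^-1) | x <- s].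
have [|T [eta [_ etaP lu ZE]]] := hyp (Z ++ s').
  move=> x /=; rewrite mem_cat => /orP[/ZO//|/mapP[y _ ->]].
  case: asboolP => // nOy; split=> // _.
  have y0 : y != 0 by apply/eqP => y0; apply: nOy; rewrite y0; split; rewrite ?eqxx.
  by case: (valuation_ge0_or_V vv y0) => // vy; case: nOy.
set E := field_adjoin K T in etaP lu ZE.
have EO : val_ring v E `<=` O by move=> x [_ vx].
(* The unit condition on the derivative is turned into its value lying outside [m]. *)
have /choice[hf hP] : forall b, exists h : {poly F}, b \in eta ->
    [/\ [set` (h : seq F)] `<=` val_ring v E, h.[b] = 0 & ~ m h^`().[b]].
  move=> b; have [/etaP[_ [h [hE h0 _ [u Ou hu]]]]|] := boolP (b \in eta); last by exists 0.
  exists h => _; split=> // [c ch|mh'].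
    by apply/asboolP; move/allP: hE => /(_ c ch).
  by apply: m1; rewrite -hu mulrC; apply: (idealM im).
have /choice[cf cP] : forall z, exists c : seq F, z \in Z ++ s' ->
    [set` c] `<=` val_ring v E /\
    forall B, subring B -> [set` c] `<=` B -> [set` eta] `<=` B -> B z.
  move=> z; have [zZ|] := boolP (z \in Z ++ s'); last by exists [::].
  by have [c cE cB] := ring_adjoin_finite (ZE z zZ); exists c.
(* All coefficients to be made regular on the model of K(T): those of the henselian polynomials, and
   those expressing [Z] and [s'] through [eta]. *)
pose Z0 := flatten [seq (hf b : seq F) | b <- eta] ++ flatten [seq cf z | z <- Z ++ s'].
have [|R0 [[[s0 R0E] R0O _] regR0 Z0R0]] := lu Z0.
  move=> y /=; rewrite mem_cat => /orP[/flatten_mapP[b be yh]|/flatten_mapP[z zZ yc]].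
    have [hE _ _] := hP b be.
    exact: hE.
  by have [cE _] := cP z zZ; apply: cE.
(* The centre is taken with respect to the valuation on [E], but as [R0] lies in [E] it is also cut
   out by [m]. *)
have cR0 : center v E R0 = R0 `&` m.
  apply/seteqP; split=> x [Rx [_ vx]]; split=> //; split=> //.
  by case: (R0O x Rx).
have sR0 : subring R0 by rewrite R0E; apply: subring_ring_adjoin.
have R0O' : R0 `<=` O by apply: subset_trans EO.
rewrite cR0 in regR0 Z0R0.
pose R := ring_adjoin R0 [set` eta].
have etaO b : b \in eta -> O b by move=> /etaP[].
have sR : subring R by apply: subring_ring_adjoin.
have RO : R `<=` O by apply: ring_adjoin_min.
have R0R : R0 `<=` R by apply: ring_adjoin_base.
have slR := subring_loc im m1 unitO sR RO.
have locR0 : localization R0 (R0 `&` m) `<=` localization R (R `&` m).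
  apply: loc_min => //.
    by move=> y /R0R/(loc_base m1 sR).
  move=> y R0y my; apply: (loc_inv im unitO RO) my.
  by apply: (loc_base m1 sR); apply: R0R.
have ZR : [set` Z ++ s'] `<=` localization R (R `&` m).
  move=> z zZ; have [_] := cP z zZ; apply.
  - exact: slR.
  - move=> y yc; apply/locR0/Z0R0; rewrite /= mem_cat; apply/orP; right.
    by apply/flatten_mapP; exists z.
  - by move=> y ye; apply: (loc_base m1 sR); apply: ring_adjoin_gen.
have cR : center v [set: F] R = R `&` m by [].
exists R; rewrite cR; split.
- split=> //.
    exists (s0 ++ eta); rewrite /R R0E ring_adjoinU; congr ring_adjoin.
    by apply/seteqP; split=> y /=; rewrite mem_cat => /orP.
  apply/seteqP; split=> // x _; have : [set: F] x by [].
  have sq := subfield_quotient_field sR.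
  have Rq y : R y -> quotient_field R y.
    by move=> Ry; exists y, 1; rewrite divr1 oner_neq0; split=> //; apply: subring1.
  rewrite Fs; apply; split=> // y [Ky|ys].
    by apply: Rq; apply: R0R; rewrite R0E; apply: ring_adjoin_base.
  (* A field generator is a fraction of elements of [R], or the inverse of one, by the choice of
     [s']. *)
  have : localization R (R `&` m) (if `[< O y >] then y else y^-1).
    by apply: ZR; rewrite /= mem_cat map_f ?orbT.
  move=> [a [b [Ra Rb nmb]]].
  have b0 : b != 0.
    by apply/eqP => b0; apply: nmb; rewrite b0; split; [apply: subring0|apply: (ideal0 im)].
  have qab : quotient_field R (a / b) by exists a, b.
  case: asboolP => _ yE; first by rewrite yE.
  have q1 : quotient_field R 1 by apply: Rq; apply: subring1.
  case: sq => _ _ qdiv; rewrite -[y]invrK yE -[(a / b)^-1]div1r; apply/asboolP.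
  by apply: qdiv; apply/asboolP.
- apply: (regular_adjoin sO im m1 unitO) => // b be; split; first exact: etaO.
  have [hE h0 h'm] := hP b be; exists (hf b); split=> // i.
  (* Only the listed coefficients are in [Z0]; those beyond the size are 0. *)
  have [szi|szi] := ltnP i (size (hf b)); last first.
    by rewrite nth_default //; apply: subring0; case: regR0.
  apply: Z0R0; rewrite /= mem_cat; apply/orP; left; apply/flatten_mapP; exists b => //.
  exact: mem_nth.
- by move=> z zZ; apply: ZR; rewrite /= mem_cat [z \in Z]zZ.
Qed.
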